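(* Let $\mathcal{E}$ be a locally free sheaf of $\mathcal{O}$-modules of finite rank on a complex supermanifold $(M,\mathcal{O})$, suppose that $\mathcal E$ has order $k$, and denote by $a_\gamma$ the cohomology class corresponding to $\mathcal{E}$ in $H^1(M,\mathcal{QA}ut_{(1)(2)}\mathrm{gr}\,\mathcal E)$. Let $(E_r,d_r)$ be the spectral sequence associated with the filtration $C^*(\mathfrak U,\mathcal E_{(p)})$, $p\ge0$, of the Čech complex $C^*(\mathfrak U,\mathcal E)$. Then $d_r=0$ for $r=1,\dots,k-1$, and $d_k=\mu_k(a_\gamma)$.
   Context: A complex supermanifold $(M,\mathcal O)$ of dimension $n|m$ is a $\mathbb Z_2$-graded ringed space locally isomorphic to a superdomain in $\mathbb C^{n|m}$; $\mathcal J\subset\mathcal O$ is the sheaf of ideals generated by $\mathcal O_{\bar 1}$, $\mathcal F=\mathcal O/\mathcal J$, $\mathrm{gr}\,\mathcal O=\bigoplus_p\mathcal J^p/\mathcal J^{p+1}$. A $\mathbb Z_2$-graded sheaf of $\mathcal O$-modules is locally free of rank $p|q$ if locally isomorphic to $\mathcal O^p\oplus\Pi(\mathcal O)^q$ ($\Pi$ the parity change). Put $\mathcal E_{(p)}=\mathcal J^p\mathcal E$ and $\mathrm{gr}\,\mathcal E=\bigoplus_p\mathrm{gr}\,\mathcal E_p$, $\mathrm{gr}\,\mathcal E_p=\mathcal E_{(p)}/\mathcal E_{(p+1)}$, a $\mathbb Z$-graded and $\mathbb Z_2$-graded locally free $\mathrm{gr}\,\mathcal O$-module. Spectral sequence: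 $\mathfrak U=(U_i)_{i\in I}$ is a Stein open cover of $M$, $C^*(\mathfrak U,\mathcal E)$ is the Čech complex with coboundary $d$, $C_{(p)}=C^*(\mathfrak U,\mathcal E_{(p)})$ (and $C_{(p)}=C_{(0)}$ for $p<0$), $C^p_r=\{c\in C_{(p)}\mid dc\in C_{(p+r)}\}$, $E^p_r=C^p_r/(C^{p+1}_{r-1}+dC^{p-r+1}_{r-1})$, $E_r=\bigoplus_pE_r^p$, and $d_r:E_r^p\to E_r^{p+r}$ is induced by $d$; $E_{r+1}\simeq H(E_r,d_r)$. With $C^{p,q}_r=C^p_r\cap C^{p+q}(\mathfrak U,\mathcal E)$ one gets the bigrading $E_r=\bigoplus E_r^{p,q}$, and $E_1^{p,q}=H^{p+q}(M,\mathrm{gr}\,\mathcal E_p)$. Quasi-automorphisms: for an automorphism $\Psi$ of the sheaf of superalgebras $\mathrm{gr}\,\mathcal O$, a $\Psi$-automorphism of $\mathrm{gr}\,\mathcal E$ is an invertible homomorphism $\Phi=\Phi_\Psi$ of $\mathbb Z_2$-graded sheaves of vector spaces with $\Phi(fv)=\Psi(f)\Phi(v)$. $\mathcal{QA}ut_{(p)(q)}\mathrm{gr}\,\mathcal E$ is the sheaf of groups of (local) $\Phi_\Psi$ with $\Phi_\Psi(v)\equiv v\bmod(\mathrm{gr}\,\mathcal E)_{(p)}$ and $\Psi(f)\equiv f\bmod\bigoplus_{s\ge q}\mathrm{gr}\,\mathcal O_s$, where $(\mathrm{gr}\,\mathcal E)_{(p)}=\bigoplus_{r\ge p}\mathrm{gr}\,\mathcal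 E_r$. Class of $\mathcal E$: choose (refining $\mathfrak U$ if necessary) isomorphisms of superalgebra sheaves $\sigma_i:\mathcal O|_{U_i}\to\mathrm{gr}\,\mathcal O|_{U_i}$ inducing the identity on $\mathrm{gr}\,\mathcal O$ and invertible parity-preserving maps $\delta_i:\mathcal E|_{U_i}\to\mathrm{gr}\,\mathcal E|_{U_i}$ with $\delta_i(fv)=\sigma_i(f)\delta_i(v)$, inducing the identity on $\mathrm{gr}\,\mathcal E$. Then $(a_\gamma)_{ij}=\delta_i\circ\delta_j^{-1}$ is a cocycle with values in $\mathcal{QA}ut_{(1)(2)}\mathrm{gr}\,\mathcal E$, and $a_\gamma$ denotes it and its class in $H^1(M,\mathcal{QA}ut_{(1)(2)}\mathrm{gr}\,\mathcal E)$ (Čech non-abelian cohomology). Order: $H_{(k)}(\mathrm{gr}\,\mathcal E)$ is the image of the natural map $H^1(M,\mathcal{QA}ut_{(k)(2)}\mathrm{gr}\,\mathcal E)\to H^1(M,\mathcal{QA}ut_{(1)(2)}\mathrm{gr}\,\mathcal E)$. The order of $\mathcal E$ is the maximal $k\geq 1$ such that the class $a_\gamma$ lies in $H_{(k)}(\mathrm{gr}\,\mathcal E)$. If the order is $k$, the $\delta_i$ are chosen so that $((a_\gamma)_{ij})$ takes values in $\mathcal{QA}ut_{(k)(2)}\mathrm{gr}\,\mathcal E$. The map $\mu_k$: for an even vector field (derivation) $\Gamma$ of $\mathrm{gr}\,\mathcal O$, a $\Gamma$-derivation of $\mathrm{gr}\,\mathcal E$ is a parity-preserving linear sheaf map $A_\Gamma$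 with $A_\Gamma(fv)=\Gamma(f)v+fA_\Gamma(v)$; maps that are $\Gamma$-derivations for some $\Gamma$ are called quasi-derivations. $\mathcal{QD}er_{(1)(2)}\mathrm{gr}\,\mathcal E$ consists of quasi-derivations $A_\Gamma$ such that $A_\Gamma$ raises the filtration $(\mathrm{gr}\,\mathcal E)_{(r)}$ by at least $1$ and $\Gamma$ raises the filtration of $\mathrm{gr}\,\mathcal O$ by at least $2$, and $\exp:\mathcal{QD}er_{(1)(2)}\mathrm{gr}\,\mathcal E\to\mathcal{QA}ut_{(1)(2)}\mathrm{gr}\,\mathcal E$ is bijective. $\mathcal{QD}er_{k,k}\mathrm{gr}\,\mathcal E$ is the sheaf of quasi-derivations $A_\Gamma$ with $A_\Gamma(\mathrm{gr}\,\mathcal E_r)\subset\mathrm{gr}\,\mathcal E_{r+k}$ and $\Gamma(\mathrm{gr}\,\mathcal O_s)\subset\mathrm{gr}\,\mathcal O_{s+k}$ for all $r,s$. The homomorphism $\mu_k:\mathcal{QA}ut_{(k)(2)}\mathrm{gr}\,\mathcal E\to\mathcal{QD}er_{k,k}\mathrm{gr}\,\mathcal E$ is $\mu_k(a)=\bigoplus_q\mathrm{pr}_{q+k}\circ A_\Gamma\circ\mathrm{pr}_q$ for $a=\exp(A_\Gamma)$, where $\mathrm{pr}_q:\mathrm{gr}\,\mathcal E\to\mathrm{gr}\,\mathcal E_q$ is the projection. The equality $d_k=\mu_k(a_\gamma)$ means: under the identification $E_k=E_1=H^*(M,\mathrm{gr}\,\mathcal E)$, $d_k$ sends the class of a Čech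 cocycle $c\in Z^q(\mathfrak U,\mathrm{gr}\,\mathcal E_p)$ to the class of the cocycle $\mu_k(a_\gamma)(c)$ with components $\mu_k((a_\gamma)_{i_0i_1})(c_{i_1\ldots i_{q+1}})$ in $Z^{q+1}(\mathfrak U,\mathrm{gr}\,\mathcal E_{p+k})$.
   Formalization: In QAut_(p)(q), Φ(v) ≡ v mod (gr E)_(p) is read as filtered: Φ − id maps (gr E)_(r) into (gr E)_(r+p) for all r. With the unfiltered condition, which is weaker for odd p ≥ 3, the claim fails (E = O of odd dimension 3 on an elliptic curve, order 3 but d_2 ≠ 0). *)

(* Defs.v *)
From HB Require Import structures.
From mathcomp Require Import all_boot all_order all_algebra.
From mathcomp Require Import complex.
From mathcomp Require Import all_classical all_reals all_analysis.

Set Implicit Arguments.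
Unset Strict Implicit.
Unset Printing Implicit Defensive.

Import Order.TTheory GRing.Theory Num.Theory.
Import numFieldNormedType.Exports.

Local Open Scope classical_set_scope.
Local Open Scope ring_scope.

Definition cplx (R : realType) : numFieldType := complex R.

(* The theory is set up over a numFieldType K; it is used with K = cplx R. *)

Section Sheaves.
Variables (K : numFieldType) (M : topologicalType).

Definition locally_on (V : set M) (P : set M -> Prop) : Prop :=
  forall x, V x -> exists W, [/\ open W, W x, W `<=` V & P W].

Definition open_cover (I : Type) (U : I -> set M) : Prop :=
  (forall i, open (U i)) /\ \bigcup_i U i = setT.

(* A sheaf of Z_2-graded K-vector spaces.  Only the values on open sets, and
   the restrictions to smaller open sets, are meaningful.  The grading is given
   by the projections par false / par true onto the even / odd parts. *)
Record vsheaf := VSheaf {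
  sec :> set M -> lmodType K;
  res : forall U V, {linear sec U -> sec V};
  par : forall U, bool -> {linear sec U -> sec U};
  res_id : forall U s, open U -> res U U s = s;
  res_comp : forall U V W s, open U -> open V -> open W ->
    V `<=` U -> W `<=` V -> res V W (res U V s) = res U W s;
  sheaf_sep : forall V (s : sec V), open V ->
    locally_on V (fun W => res V W s = 0) -> s = 0;
  sheaf_glue : forall (I : Type) (U : I -> set M) V (s : forall i, sec (U i)),
    (forall i, open (U i)) -> V = \bigcup_i U i ->
    (forall i j, res (U i) (U i `&` U j) (s i) =
                 res (U j) (U i `&` U j) (s j)) ->
    exists t : sec V, forall i, res V (U i) t = s i;
  par_sum : forall U s, par U false s + par U true s = s;
  par_proj : forall U b b' s,
    par U b (par U b' s) = if b == b' then par U b s else 0;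
  par_res : forall U V b s, open U -> open V -> V `<=` U ->
    par V b (res U V s) = res U V (par U b s)
}.

Local Arguments res {v} U V.
Local Arguments par {v} U b.

(* Multiplication is not packed as an algType because the algebra of sections
   over the empty set is zero. *)
Record sasheaf := SASheaf {
  sa_sheaf :> vsheaf;
  mul : forall U, sa_sheaf U -> sa_sheaf U -> sa_sheaf U;
  one : forall U, sa_sheaf U;
  mul_linl : forall U a (f g h : sa_sheaf U),
    mul (a *: f + g) h = a *: mul f h + mul g h;
  mul_linr : forall U a (f g h : sa_sheaf U),
    mul f (a *: g + h) = a *: mul f g + mul f h;
  mul_assoc : forall U (f g h : sa_sheaf U), mul f (mul g h) = mul (mul f g) h;
  mul_onel : forall U (f : sa_sheaf U), mul (one U) f = f;
  mul_oner : forall U (f : sa_sheaf U), mul f (one U) = f;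
  mul_par : forall U b b' (f g : sa_sheaf U),
    par U (b (+) b') (mul (par U b f) (par U b' g)) =
    mul (par U b f) (par U b' g);
  one_par : forall U, par U false (one U) = one U;
  res_mul : forall U V (f g : sa_sheaf U), open U -> open V -> V `<=` U ->
    res U V (mul f g) = mul (res U V f) (res U V g);
  res_one : forall U V, open U -> open V -> V `<=` U ->
    res U V (one U) = one V
}.

Record msheaf (O : sasheaf) := MSheaf {
  ms_sheaf :> vsheaf;
  act : forall U, O U -> ms_sheaf U -> ms_sheaf U;
  act_linl : forall U a (f g : O U) (v : ms_sheaf U),
    act (a *: f + g) v = a *: act f v + act g v;
  act_linr : forall U a (f : O U) (v w : ms_sheaf U),
    act f (a *: v + w) = a *: act f v + act f w;
  act_assoc : forall U (f g : O U) (v : ms_sheaf U),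
    act f (act g v) = act (mul f g) v;
  act_one : forall U (v : ms_sheaf U), act (one O U) v = v;
  act_par : forall U b b' (f : O U) (v : ms_sheaf U),
    par U (b (+) b') (act (par U b f) (par U b' v)) =
    act (par U b f) (par U b' v);
  res_act : forall U V (f : O U) (v : ms_sheaf U),
    open U -> open V -> V `<=` U ->
    res U V (act f v) = act (res U V f) (res U V v)
}.

Definition reg (O : sasheaf) : msheaf O :=
  @MSheaf O O (@mul O) (@mul_linl O) (@mul_linr O) (@mul_assoc O)
    (@mul_onel O) (@mul_par O) (@res_mul O).

(* Families of maps F(V) -> G(V); a sheaf morphism over U is such a family,
   considered only on the open subsets V of U. *)
Definition fam (F G : vsheaf) := forall V : set M, F V -> G V.

Definition fam_eq (U : set M) (F G : vsheaf) (phi psi : fam F G) : Prop :=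
  forall V s, open V -> V `<=` U -> phi V s = psi V s.

Definition fam_inv (F G : vsheaf) (phi : fam F G) : fam G F :=
  fun V t => xget 0 [set s | phi V s = t].

Definition is_hom (U : set M) (F G : vsheaf) (phi : fam F G) : Prop :=
  forall V, open V -> V `<=` U ->
  [/\ forall a s t, phi V (a *: s + t) = a *: phi V s + phi V t,
      forall b s, phi V (par V b s) = par V b (phi V s)
    & forall W s, open W -> W `<=` V ->
        phi W (res V W s) = res V W (phi V s)].

Definition is_iso (U : set M) (F G : vsheaf) (phi : fam F G) : Prop :=
  is_hom U phi /\ forall V, open V -> V `<=` U -> bijective (phi V).

Definition is_alg_iso (U : set M) (O O' : sasheaf) (sigma : fam O O') : Prop :=
  is_iso U sigma /\
  forall V, open V -> V `<=` U ->
    (forall f g, sigma V (mul f g) = mul (sigma V f) (sigma V g)) /\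
    sigma V (one O V) = one O' V.

Definition semilinear_over (U : set M) (O O' : sasheaf) (E : msheaf O)
    (E' : msheaf O') (sigma : fam O O') (delta : fam E E') : Prop :=
  forall V f v, open V -> V `<=` U ->
    delta V (act f v) = act (sigma V f) (delta V v).

(* On the superdomains used below O is supercommutative, so the left ideal
   generated by the odd sections is the two-sided one. *)
Definition inJ (O : sasheaf) (V : set M) (f : O V) : Prop :=
  locally_on V (fun W => exists (N : nat) (g h : 'I_N -> O W),
    res V W f = \sum_(l < N) mul (g l) (par W true (h l))).

Fixpoint filt (O : sasheaf) (E : msheaf O) (p : nat) (V : set M) (e : E V)
    : Prop :=
  if p is p'.+1 then
    locally_on V (fun W => exists (N : nat) (f : 'I_N -> O W) (e' : 'I_N -> E W),
      (forall l, inJ (f l) /\ filt p' (e' l)) /\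
      res V W e = \sum_(l < N) act (f l) (e' l))
  else True.

(* The parity change is Pi(O) = O with the same left action and the opposite
   parity, whence the twist ~~ b on the last q components. *)
Definition locally_free (p q : nat) (O : sasheaf) (E : msheaf O) : Prop :=
  locally_on setT (fun U =>
    exists theta : forall V, ('I_p + 'I_q -> O V) -> E V,
    forall V, open V -> V `<=` U ->
    [/\ bijective (theta V),
        forall a g h,
          theta V (fun l => a *: g l + h l) = a *: theta V g + theta V h,
        forall f g, theta V (fun l => mul f (g l)) = act f (theta V g),
        forall b g,
          theta V (fun l => match l with
                            | inl _ => par V b (g l)
                            | inr _ => par V (~~ b) (g l)
                            end) = par V b (theta V g)
      & forall W g, open W -> W `<=` V ->
          theta W (fun l => res V W (g l)) = res V W (theta V g)]).

End Sheaves.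

Arguments res {K M v} U V.
Arguments par {K M v} U b.
Arguments one {K M} s U.

Section Supermanifolds.
Variables (K : numFieldType) (M : topologicalType) (n m : nat).

(* A superfunction f = \sum_I f_I xi_I on a domain of K^{n|m} is given by its
   coefficients f_I, where xi_I is the product of the xi_i, i \in I, taken in
   increasing order. *)
Definition superfun := {set 'I_m} -> 'rV[K]_n -> K.

Definition gsign (I J : {set 'I_m}) : K :=
  (-1) ^+ #|[pred ij : 'I_m * 'I_m |
             [&& ij.1 \in I, ij.2 \in J & (ij.2 < ij.1)%N]]|.

Definition smul (f g : superfun) : superfun := fun L z =>
  \sum_(I : {set 'I_m} | I \subset L)
    gsign I (L :\: I)%SET * f I z * g (L :\: I)%SET z.

Definition holomorphic_on (D : set 'rV[K]_n) (f : 'rV[K]_n -> K) : Prop :=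
  forall z, D z -> differentiable f z.

(* An isomorphism of O|_U with the superdomain phi(U): the first clauses say
   that phi is a homeomorphism onto an open set. *)
Record is_chart (O : sasheaf K M) (U : set M) (phi : M -> 'rV[K]_n)
    (theta : forall V, O V -> superfun) : Prop := IsChart {
  chart_inj : set_inj U phi;
  chart_open : forall V, V `<=` U -> (open V <-> open (phi @` V));
  chart_lin : forall V a f g I z, open V -> V `<=` U -> (phi @` V) z ->
    theta V (a *: f + g) I z = a * theta V f I z + theta V g I z;
  chart_mul : forall V f g I z, open V -> V `<=` U -> (phi @` V) z ->
    theta V (mul f g) I z = smul (theta V f) (theta V g) I z;
  chart_one : forall V I z, open V -> V `<=` U -> (phi @` V) z ->
    theta V (one O V) I z = (I == finset.set0)%:R;
  chart_par : forall V b f I z, open V -> V `<=` U -> (phi @` V) z ->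
    theta V (par V b f) I z = if odd #|I| == b then theta V f I z else 0;
  chart_res : forall V W f I z, open V -> V `<=` U -> open W -> W `<=` V ->
    (phi @` W) z -> theta W (res V W f) I z = theta V f I z;
  chart_holo : forall V f I, open V -> V `<=` U ->
    holomorphic_on (phi @` V) (theta V f I);
  chart_injective : forall V f, open V -> V `<=` U ->
    (forall I z, (phi @` V) z -> theta V f I z = 0) -> f = 0;
  chart_surjective : forall V (g : superfun), open V -> V `<=` U ->
    (forall I, holomorphic_on (phi @` V) (g I)) ->
    exists f, forall I z, (phi @` V) z -> theta V f I z = g I z
}.

Definition supermanifold (O : sasheaf K M) : Prop :=
  locally_on setT (fun U => exists phi theta, @is_chart O U phi theta).

End Supermanifolds.

Section Graded.
Variables (K : numFieldType) (M : topologicalType).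

(* (G, pr, pi) is a model of the graded sheaf \bigoplus_p J^p E / J^{p+1} E:
   pr p is the projection onto the degree p part, and pi p : J^p E -> gr E_p
   is the quotient map, i.e. it has kernel J^{p+1} E and is locally surjective.
   The values of pi p outside J^p E are meaningless.  These properties
   determine G up to a unique isomorphism. *)
Record is_gr (O : sasheaf K M) (E : msheaf O) (G : vsheaf K M)
    (pr : nat -> forall V, {linear G V -> G V}) (pi : nat -> fam E G)
    : Prop := IsGr {
  gr_pr_res : forall p V W v, open V -> open W -> W `<=` V ->
    pr p W (res V W v) = res V W (pr p V v);
  gr_pr_par : forall p V b v, pr p V (par V b v) = par V b (pr p V v);
  gr_pr_proj : forall p q V v,
    pr p V (pr q V v) = if p == q then pr p V v else 0;
  gr_pr_sum : forall V (v : G V), open V -> locally_on V (fun W =>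
    exists N, res V W v = \sum_(q < N) pr q W (res V W v));
  gr_pi_lin : forall p V a e e', open V -> filt p e -> filt p e' ->
    pi p V (a *: e + e') = a *: pi p V e + pi p V e';
  gr_pi_res : forall p V W e, open V -> open W -> W `<=` V -> filt p e ->
    pi p W (res V W e) = res V W (pi p V e);
  gr_pi_par : forall p V b e, open V -> filt p e ->
    pi p V (par V b e) = par V b (pi p V e);
  gr_pi_pr : forall p V e, open V -> filt p e ->
    pr p V (pi p V e) = pi p V e;
  gr_pi_ker : forall p V e, open V -> filt p e ->
    (pi p V e = 0 <-> filt p.+1 e);
  gr_pi_surj : forall p V v, open V -> pr p V v = v ->
    locally_on V (fun W => exists2 e, filt p e & pi p W e = res V W v)
}.

Record gralg (O : sasheaf K M) := GrAlg {
  ga_sheaf :> sasheaf K M;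
  ga_pr : nat -> forall V, {linear ga_sheaf V -> ga_sheaf V};
  ga_pi : nat -> fam O ga_sheaf;
  ga_gr : is_gr (E := reg O) ga_pr ga_pi;
  ga_mul : forall p q V (f g : O V), open V ->
    filt (E := reg O) p f -> filt (E := reg O) q g ->
    mul (ga_pi p f) (ga_pi q g) = ga_pi (p + q)%N (mul f g);
  ga_one : forall V, open V -> ga_pi 0%N (one O V) = one ga_sheaf V
}.

Record grmod (O : sasheaf K M) (GO : gralg O) (E : msheaf O) := GrMod {
  gm_sheaf :> msheaf GO;
  gm_pr : nat -> forall V, {linear gm_sheaf V -> gm_sheaf V};
  gm_pi : nat -> fam E gm_sheaf;
  gm_gr : is_gr gm_pr gm_pi;
  gm_act : forall p q V (f : O V) (e : E V), open V ->
    filt (E := reg O) p f -> filt q e ->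
    act (ga_pi GO p f) (gm_pi q e) = gm_pi (p + q)%N (act f e)
}.

Definition gfilt (G : vsheaf K M) (pr : nat -> forall V, {linear G V -> G V})
    (p : nat) (V : set M) (v : G V) : Prop :=
  forall r, (r < p)%N -> pr r V v = 0.

Definition induces_id (O : sasheaf K M) (E : msheaf O) (G : vsheaf K M)
    (pr : nat -> forall V, {linear G V -> G V}) (pi : nat -> fam E G)
    (U : set M) (phi : fam E G) : Prop :=
  forall p V e, open V -> V `<=` U -> filt p e ->
    gfilt pr p (phi V e) /\ pr p V (phi V e) = pi p V e.

End Graded.

Section Stein.
Variables (K : numFieldType) (M : topologicalType).
Variables (O : sasheaf K M) (GO : gralg O).

(* Sections of F = O/J = gr O_0, as functions: c is the value of s at x when
   s - c is invertible in no neighbourhood of x. *)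
Definition Fsec (U : set M) : set (GO U) := [set s | ga_pr GO 0 U s = s].

Definition value_at (U : set M) (s : GO U) (x : M) (c : K) : Prop :=
  forall W, open W -> W x -> W `<=` U ->
  ~ exists t, mul (res U W s - c *: one GO W) t = one GO W.

Definition hol_hull (U A : set M) : set M :=
  [set x | U x /\ forall (s : GO U) (b : K), Fsec s ->
     (forall y c, A y -> value_at s y c -> `|c| <= b) ->
     forall c, value_at s x c -> `|c| <= b].

Definition stein (U : set M) : Prop :=
  [/\ open U,
      forall x y, U x -> U y -> x <> y -> exists (s : GO U) (c c' : K),
        [/\ Fsec s, value_at s x c, value_at s y c' & c <> c']
    & forall A, A `<=` U -> compact A -> compact (hol_hull U A)].

End Stein.

Section QuasiAutomorphisms.
Variables (K : numFieldType) (M : topologicalType).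
Variables (O : sasheaf K M) (GO : gralg O).
Variables (E : msheaf O) (GE : grmod GO E).

Local Notation prO := (ga_pr GO).
Local Notation prE := (gm_pr GE).

(* Sections over U of the sheaf of groups QAut_(p)(q).  The congruence
   Phi(v) = v mod (gr E)_(p) is relative to the filtration: Phi - id raises the
   filtration of gr E by p.  For odd p >= 3 it does not suffice to require
   Phi(v) - v \in (gr E)_(p) for all v: this would allow Phi = exp(A) with
   A(xi w) = Gamma(xi) w and Gamma(xi) of degree p, which raises degrees by
   p - 1 only. *)
Definition QAut (p q : nat) (U : set M) (Phi : fam GE GE) : Prop :=
  exists Psi : fam GO GO,
  [/\ is_alg_iso U Psi, is_iso U Phi, semilinear_over U Psi Phi,
      forall V r v, open V -> V `<=` U -> gfilt prE r v ->
        gfilt prE (r + p) (Phi V v - v)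
    & forall V f, open V -> V `<=` U -> gfilt prO q (Psi V f - f)].

Definition qcocycle (p q : nat) (I : Type) (U : I -> set M)
    (a : I -> I -> fam GE GE) : Prop :=
  (forall i j, QAut p q (U i `&` U j) (a i j)) /\
  forall i j l, fam_eq (U i `&` U j `&` U l)
    (fun V v => a i j V (a j l V v)) (a i l).

(* Equality of the classes of two cocycles, on possibly different covers, in
   H^1(M, QAut_(p)(q)): they become cohomologous on a common refinement. *)
Definition same_class (p q : nat) (I : Type) (U : I -> set M)
    (a : I -> I -> fam GE GE) (J : Type) (V : J -> set M)
    (b : J -> J -> fam GE GE) : Prop :=
  exists (L : Type) (W : L -> set M) (t : L -> I) (t' : L -> J)
         (h : L -> fam GE GE),
  [/\ open_cover W,
      forall l, W l `<=` U (t l) /\ W l `<=` V (t' l),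
      forall l, QAut p q (W l) (h l)
    & forall l l', fam_eq (W l `&` W l')
        (fun X v => a (t l) (t l') X (h l' X v))
        (fun X v => h l X (b (t' l) (t' l') X v))].

Definition inH (k : nat) (I : Type) (U : I -> set M)
    (a : I -> I -> fam GE GE) : Prop :=
  exists (J : Type) (V : J -> set M) (b : J -> J -> fam GE GE),
  [/\ open_cover V, qcocycle k 2 V b & same_class 1 2 U a V b].

Definition has_order (k : nat) (I : Type) (U : I -> set M)
    (a : I -> I -> fam GE GE) : Prop :=
  [/\ (1 <= k)%N, inH k U a
    & forall l, (1 <= l)%N -> inH l U a -> (l <= k)%N].

Definition is_splitting (I : Type) (U : I -> set M) (sigma : I -> fam O GO)
    (delta : I -> fam E GE) : Prop :=
  forall i,
  [/\ is_alg_iso (U i) (sigma i),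
      induces_id (E := reg O) prO (ga_pi GO) (U i) (sigma i),
      is_iso (U i) (delta i), semilinear_over (U i) (sigma i) (delta i)
    & induces_id prE (gm_pi GE) (U i) (delta i)].

Definition agamma (I : Type) (delta : I -> fam E GE) (i j : I) : fam GE GE :=
  fun V v => delta i V (fam_inv (delta j) v).

(* Sections over U of QDer_(1)(2). *)
Definition QDer12 (U : set M) (A : fam GE GE) : Prop :=
  exists Gam : fam GO GO,
  [/\ is_hom U Gam, is_hom U A,
      forall V f g, open V -> V `<=` U ->
        Gam V (mul f g) = mul (Gam V f) g + mul f (Gam V g),
      forall V f v, open V -> V `<=` U ->
        A V (act f v) = act (Gam V f) v + act f (A V v)
    & forall V r, open V -> V `<=` U ->
        (forall v, gfilt prE r v -> gfilt prE r.+1 (A V v)) /\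
        (forall f, gfilt prO r f -> gfilt prO r.+2 (Gam V f))].

(* m is the odd dimension: gr E_p = 0 for p > m, so that A^{m+1} = 0 for A in
   QDer_(1)(2), and the sums below contain all the nonzero terms. *)
Variable m : nat.

Definition qexp (A : fam GE GE) : fam GE GE :=
  fun V v => \sum_(l < m.+1) (l`!%:R : K)^-1 *: iter l (A V) v.

Definition qlog (U : set M) (a : fam GE GE) : fam GE GE :=
  if pselect (exists A, QDer12 U A /\ fam_eq U (qexp A) a) is left h
  then projT1 (cid h) else fun V v => v.

Definition mu (k : nat) (U : set M) (a : fam GE GE) : fam GE GE :=
  fun V v => \sum_(q < m.+1) prE (q + k) V (qlog U a (prE q V v)).

End QuasiAutomorphisms.

Section Cech.
Variables (K : numFieldType) (M : topologicalType) (I : Type) (U : I -> set M).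

Definition inter (n : nat) (s : 'I_n.+1 -> I) : set M :=
  [set x | forall j, U (s j) x].

Definition cochain (F : vsheaf K M) (n : nat) :=
  forall s : 'I_n.+1 -> I, F (inter s).

Definition cechd (F : vsheaf K M) (n : nat) (c : cochain F n)
    : cochain F n.+1 :=
  fun s => \sum_(j < n.+2) (-1) ^+ j *: res _ (inter s) (c (s \o lift j)).

Definition cech_im (F : vsheaf K M) (A : forall n, set (cochain F n)) (n : nat)
    : set (cochain F n) :=
  match n with
  | 0 => [set fun=> 0]
  | n'.+1 => [set cechd c | c in A n']
  end.

Definition coset (F : vsheaf K M) (n : nat) (B : set (cochain F n))
    (x : cochain F n) : set (cochain F n) :=
  [set y | B (fun s => y s - x s)].

Section SpectralSequence.
Variables (O : sasheaf K M) (E : msheaf O).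

(* C_(p) in degree n, with C_(p) = C_(0) for p < 0. *)
Definition Cfil (p : int) (n : nat) : set (cochain E n) :=
  [set c | forall s, filt (if p is Posz p' then p' else 0%N) (c s)].

(* C^p_r in degree n. *)
Definition Cspec (r p : int) (n : nat) : set (cochain E n) :=
  [set c | Cfil p c /\ Cfil (p + r) (cechd c)].

Definition Bspec (r p : int) (n : nat) : set (cochain E n) :=
  [set c | exists x y, [/\ Cspec (r - 1) (p + 1) x,
                           cech_im (Cspec (r - 1) (p - r + 1)) y
                         & c = fun s => x s + y s]].

(* E_r^{p, n - p}, realized as the set of the cosets of Bspec r p in
   Cspec r p; here n is the total degree. *)
Definition Espec (r p : int) (n : nat) : set (set (cochain E n)) :=
  [set coset (@Bspec r p n) x | x in @Cspec r p n].

Definition dspec (r p : int) (n : nat) (A : set (cochain E n))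
    : set (cochain E n.+1) :=
  [set z | exists2 x, A x & coset (@Bspec r (p + r) n.+1) (cechd x) z].

Definition zspec (r p : int) (n : nat) : set (cochain E n) :=
  coset (@Bspec r p n) (fun=> 0).

Variables (GO : gralg O) (GE : grmod GO E).

Definition Cgr (p n : nat) : set (cochain GE n) :=
  [set c | forall s, gm_pr GE p _ (c s) = c s].

Definition Zgr (p n : nat) : set (cochain GE n) :=
  [set c | Cgr p c /\ cechd c = fun=> 0].

Definition Hclass (p n : nat) (c : cochain GE n) : set (cochain GE n) :=
  coset (cech_im (Cgr p) (n := n)) c.

Definition Hgr (p n : nat) : set (set (cochain GE n)) :=
  [set @Hclass p n c | c in Zgr p (n := n)].

(* The identification of E_r^{p, n - p} with H^n(gr E_p) when d_1, ..., d_{r-1}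
   vanish.  The isomorphism of E_{s+1} with H(E_s, d_s) = E_s sends the class
   of x to the class of x, and that of E_1 with H(gr E) sends the class of x to
   the class of pi_p(x). *)
Definition ident (p n : nat) (A : set (cochain E n)) : set (cochain GE n) :=
  [set c | exists2 x, A x & Hclass p (fun s => gm_pi GE p (x s)) c].

Definition mu_cochain (m k n : nat) (a : I -> I -> fam GE GE)
    (c : cochain GE n) : cochain GE n.+1 :=
  fun s => let i0 := s ord0 in let i1 := s (lift ord0 ord0) in
    mu m k (U i0 `&` U i1) (a i0 i1)
      (res _ (inter s) (c (s \o lift ord0))).

End SpectralSequence.
End Cech.

Arguments Espec {K M I} U {O} E r p n.
Arguments zspec {K M I} U {O} E r p n.
Arguments Hgr {K M I} U {O E GO} GE p n.
Arguments ident {K M I U O E GO} GE p {n} A.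

(* Main.v *)
(* Through local isomorphisms delta_i of E with gr E, a cochain x of E becomes
   the cochain y = delta_(i0) x of gr E, and the Cech coboundary becomes
   y |-> d y + (a - 1) y, where (a - 1) acts through a_(i0 i1) on the face
   omitting i0.  As a - 1 raises the filtration by k, only d is visible below
   degree p + k; this gives d_r = 0 for r < k and identifies E_k with H(gr E),
   and d_k is the component of degree k of a - 1.  That component is mu_k(a),
   the leading term of log a, provided that log a exists, that is, that log a is
   a quasi-derivation.  With a = 1 + N and N nilpotent, a^t is a polynomial in
   the natural number t whose coefficient of t is log a, and comparing the
   coefficients of t in a^t (f v) = Psi^t(f) a^t(v) yields the Leibniz rule. *)

From Pilot Require Import Defs.
From HB Require Import structures.
From mathcomp Require Import all_boot all_order all_algebra.
From mathcomp Require Import complex.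
From mathcomp Require Import all_classical all_reals all_analysis.
From mathcomp Require Import zify.

Set Implicit Arguments.
Unset Strict Implicit.
Unset Printing Implicit Defensive.

Import Order.TTheory GRing.Theory Num.Theory.
Import numFieldNormedType.Exports.
Import Pilot.Defs.

Local Open Scope classical_set_scope.
Local Open Scope ring_scope.

(** Nilpotency of N comes from J^(m+1) = 0, with m the odd dimension, which is read off from the
    coefficients of superfunctions in a chart. Two gaps between the definitions shape the rest.
    [QAut] asks of Psi only that Psi(f) - f has degree at least 2, whatever the degree of f, whereas
    the derivation in [QDer12] must raise every step of the filtration by 2; multiplicativity,
    together with the agreement of parity and degree in gr O, supplies the difference. And [mu] uses
    a logarithm A picked by choice, specified only as an element of [QDer12] with exponential a;
    that A raises degrees by k is recovered by a bootstrap, because a - 1 - A raises degrees twice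
    as much as A does. Identities between power series are replaced by identities between iterates:
    a polynomial in t with vector coefficients is determined by its values at natural numbers, as K
    has characteristic 0. Since the terms E_r are sets of cosets, equalities between them become
    memberships in subgroups of cochains. *)

Section LinearMaps.
Variables (K : numFieldType) (V W : lmodType K) (f : V -> W).
Hypothesis f_linear : linear f.

Let f_pack : {linear V -> W} :=
  HB.pack_for {linear V -> W} f (GRing.isLinear.Build K V W *:%R f f_linear).

Lemma linear_fun0 : f 0 = 0. Proof. exact: (linear0 f_pack). Qed.

Lemma linear_funD v w : f (v + w) = f v + f w.
Proof. exact: (linearD f_pack). Qed.

Lemma linear_funB v w : f (v - w) = f v - f w.
Proof. exact: (linearB f_pack). Qed.

Lemma linear_funZ a v : f (a *: v) = a *: f v.
Proof. exact: (linearZ_LR f_pack). Qed.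

Lemma linear_fun_sum (I : Type) (r : seq I) (P : pred I) (F : I -> V) :
  f (\sum_(i <- r | P i) F i) = \sum_(i <- r | P i) f (F i).
Proof. exact: (linear_sum f_pack). Qed.

End LinearMaps.

(** The weights are a column of the inverse Vandermonde matrix at the nodes 0, ..., n - 1, which are
    distinct in characteristic 0. *)
Lemma coef_extraction (K : numFieldType) (n : nat) (l : 'I_n) :
  exists c : 'I_n -> K, forall k : 'I_n,
    \sum_(t < n) c t * t%:R ^+ k = (k == l)%:R.
Proof.
pose a : 'rV[K]_n := \row_t t%:R; pose V := Vandermonde n a.
have Vu : V \in unitmx.
  rewrite unitmxE det_Vandermonde unitfE prodf_seq_neq0; apply/allP => i _ /=.
  rewrite prodf_seq_neq0; apply/allP => j _ /=; apply/implyP => ij.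
  by rewrite !mxE subr_eq0 eqr_nat neq_ltn ij orbT.
exists (fun t => (invmx V) t l) => k.
have := mulmxV Vu => /matrixP /(_ k l); rewrite !mxE => <-.
by apply: eq_bigr => t _; rewrite !mxE mulrC.
Qed.

Lemma vpoly_coef (K : numFieldType) (V : lmodType K) (n : nat) (v w : nat -> V) :
  (forall t : nat, \sum_(k < n) (t%:R : K) ^+ k *: v k =
                   \sum_(k < n) (t%:R : K) ^+ k *: w k) ->
  forall l, (l < n)%N -> v l = w l.
Proof.
move=> vw l ln; have [c cP] := coef_extraction K (Ordinal ln).
have coefE (u : nat -> V) :
    u l = \sum_(t < n) c t *: (\sum_(k < n) (t%:R : K) ^+ k *: u k).
  under eq_bigr do rewrite scaler_sumr.
  rewrite exchange_big /= (bigD1 (Ordinal ln)) //= [X in _ + X]big1 => [|k kl].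
    under eq_bigr do rewrite scalerA.
    by rewrite addr0 -scaler_suml (cP (Ordinal ln)) eqxx scale1r.
  under eq_bigr do rewrite scalerA.
  by rewrite -scaler_suml cP (negPf kl) scale0r.
by rewrite coefE [RHS]coefE; apply: eq_bigr => t _; rewrite vw.
Qed.

(** * Binomial coefficients as polynomials in the upper argument *)

Section BinomialPolynomial.
Variable K : numFieldType.

(** For j >= 1 the coefficient of X in this polynomial is (-1)^(j-1) / j, so the logarithm series
    arises below without being written out. *)
Definition bin_poly (j : nat) : {poly K} :=
  (j`!%:R)^-1 *: \prod_(i < j) ('X - i%:R%:P).

Lemma horner_bin_poly j t : (bin_poly j).[t%:R] = 'C(t, j)%:R.
Proof.
rewrite hornerZ horner_prod.
have -> : \prod_(i < j) ('X - i%:R%:P).[t%:R] = (t ^_ j)%:R :> K.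
  elim: j => [|j IH]; first by rewrite big_ord0.
  rewrite big_ord_recr /= IH hornerXsubC ffactnSr natrM.
  have [jt|tj] := leqP j t; first by rewrite natrB.
  by rewrite ffact_small // !mul0r.
by rewrite -bin_ffact natrM mulrCA mulVf ?mulr1 // pnatr_eq0 -lt0n fact_gt0.
Qed.

Lemma size_bin_poly j : (size (bin_poly j) <= j.+1)%N.
Proof.
apply: leq_trans (size_scale_leq _ _) _.
by rewrite size_prod_XsubC /index_enum -enumT size_enum_ord.
Qed.

Lemma bin_poly_coef0 j : (bin_poly j)`_0 = (j == 0)%:R.
Proof. by rewrite -horner_coef0 (horner_bin_poly j 0) bin0n; case: j. Qed.

Lemma bin_poly0_coef1 : (bin_poly 0)`_1 = 0.
Proof. by apply: nth_default; apply: size_bin_poly. Qed.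

End BinomialPolynomial.

(** * Powers, logarithm and exponential of a unipotent map *)

Section Unipotent.
Variables (K : numFieldType) (m : nat).

Definition dev (V : lmodType K) (phi : V -> V) (v : V) : V := phi v - v.

(* With N = dev phi and N ^ (m + 1) = 0, ucoef phi k is the coefficient of t^k
   in phi^t = \sum_j binomial(t, j) N^j; in particular ucoef phi 1 = log phi. *)
Definition ucoef (V : lmodType K) (phi : V -> V) (k : nat) (v : V) : V :=
  \sum_(j < m.+1) (bin_poly K j)`_k *: iter j (dev phi) v.

Definition unipotent (V : lmodType K) (phi : V -> V) :=
  forall v, iter m.+1 (dev phi) v = 0.

Lemma iter_nil_linear (V : lmodType K) (phi : {linear V -> V}) j :
  linear (iter j (dev phi)).
Proof.
elim: j => [//|j IH] a x y; rewrite !iterS IH /dev linearP scalerBr.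
by rewrite opprD addrACA.
Qed.

Lemma ucoef_linear (V : lmodType K) (phi : {linear V -> V}) k :
  linear (ucoef phi k).
Proof.
move=> a x y; rewrite /ucoef scaler_sumr -big_split; apply: eq_bigr => j _ /=.
by rewrite iter_nil_linear scalerDr !scalerA mulrC.
Qed.

HB.instance Definition _ (V : lmodType K) (phi : {linear V -> V}) k :=
  GRing.isLinear.Build K V V *:%R (ucoef phi k) (ucoef_linear phi k).

Lemma ucoef0 (V : lmodType K) (phi : V -> V) v : ucoef phi 0 v = v.
Proof.
rewrite /ucoef big_ord_recl big1 => [|j _].
  by rewrite bin_poly_coef0 scale1r addr0.
by rewrite bin_poly_coef0 scale0r.
Qed.

(** Since phi = 1 + N, applying phi adds a shifted copy of the sum; Pascal's rule collects the two,
    and the top shifted term contains N^(m+1) = 0. *)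
Lemma iter_unipotent_bin (V : lmodType K) (phi : {linear V -> V}) t (v : V) :
  unipotent phi ->
  iter t phi v = \sum_(j < m.+1) 'C(t, j)%:R *: iter j (dev phi) v.
Proof.
move=> phiU; elim: t => [|t IH] /=.
  rewrite big_ord_recl big1 /= => [|j _]; last by rewrite bin0n scale0r.
  by rewrite scale1r addr0.
rewrite IH linear_sum /=.
have step (j : nat) (u : V) : phi ('C(t, j)%:R *: iter j (dev phi) u) =
    'C(t, j)%:R *: iter j (dev phi) u +
    'C(t, j)%:R *: iter j.+1 (dev phi) u.
  by rewrite linearZ /= -scalerDr /dev addrC subrK.
under eq_bigr do rewrite step.
rewrite big_split /= [X in _ + X]big_ord_recr /=.
have -> : dev phi (iter m (dev phi) v) = 0 by exact: phiU.
rewrite scaler0 addr0 2!big_ord_recl !bin0 -addrA; congr (_ + _).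
by rewrite -big_split; apply: eq_bigr => j _ /=; rewrite binS natrD scalerDl.
Qed.

(** The length [M] is left free above m so that the two sides of a comparison of coefficients can be
    padded to a common length. *)
Lemma iter_unipotent (V : lmodType K) (phi : {linear V -> V}) M t (v : V) :
  unipotent phi -> (m < M)%N ->
  iter t phi v = \sum_(k < M) (t%:R : K) ^+ k *: ucoef phi k v.
Proof.
move=> phiU mM; rewrite iter_unipotent_bin //.
under [RHS]eq_bigr do rewrite scaler_sumr.
rewrite exchange_big; apply: eq_bigr => j _ /=.
under eq_bigr do rewrite scalerA mulrC.
rewrite -scaler_suml -horner_bin_poly (@horner_coef_wide _ M) //.
by apply: leq_trans (size_bin_poly K j) _; apply: leq_trans mM; apply: ltn_ord.
Qed.

Lemma ucoef_out (V : lmodType K) (phi : V -> V) k v :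
  (m < k)%N -> ucoef phi k v = 0.
Proof.
move=> mk; rewrite /ucoef big1 // => j _; rewrite nth_default ?scale0r //.
apply: leq_trans (size_bin_poly K j) _.
by apply: leq_trans mk; apply: ltn_ord.
Qed.

(* Comparison of the coefficients of s^1 t^k in phi^(s+t) = phi^s phi^t. *)
Lemma ucoefS (V : lmodType K) (phi : {linear V -> V}) k (v : V) :
  unipotent phi -> k.+1%:R *: ucoef phi k.+1 v = ucoef phi 1 (ucoef phi k v).
Proof.
(* Working with m + 2 coefficients keeps the coefficient of degree 1 in range even when m = 0. *)
move=> phiU; have [km|mk] := ltnP k m.+2; last first.
  by rewrite (ucoef_out _ _ (ltnW mk)) ucoef_out ?linear0 ?scaler0 // ltnW // ltnW.
apply: (@vpoly_coef K V m.+2 (fun k => k.+1%:R *: ucoef phi k.+1 v)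
          (fun k => ucoef phi 1 (ucoef phi k v))) (km) => t.
(* [c i] is the coefficient of s^i in phi^(s+t) v, obtained from the binomial expansion of (s +
   t)^l. *)
pose c i := \sum_(l < m.+2) ((t%:R : K) ^+ (l - i) *+ 'C(l, i)) *: ucoef phi l v.
have cE : c 1%N = ucoef phi 1 (iter t phi v).
  apply: (@vpoly_coef K V m.+2 c (fun i => ucoef phi i (iter t phi v))) => // s.
  rewrite -(iter_unipotent s _ phiU) // -iterD (iter_unipotent _ _ phiU (M := m.+2)) //.
  under eq_bigr do rewrite scaler_sumr.
  rewrite exchange_big; apply: eq_bigr => l _ /=.
  under eq_bigr do rewrite scalerA.
  rewrite -scaler_suml; congr (_ *: _).
  rewrite natrD addrC exprDn.
  rewrite (big_ord_widen _ (fun i => t%:R ^+ (l - i) * s%:R ^+ i *+ 'C(l, i) : K)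
             (ltn_ord l)).
  rewrite [RHS]big_mkcond; apply: eq_bigr => i _.
  rewrite ltnS; case: leqP => [_|li]; first by rewrite mulrnAr mulrC.
  by rewrite bin_small // mulr0n mulr0.
transitivity (c 1%N); last first.
  by rewrite cE (iter_unipotent _ _ phiU (M := m.+2)) // linear_sum;
    apply: eq_bigr => i _; rewrite linearZ.
rewrite /c [LHS]big_ord_recr [RHS]big_ord_recl /= (ucoef_out _ _ (leqnSn _)).
rewrite !scaler0 bin0n mulr0n scale0r addr0 add0r; apply: eq_bigr => i _.
by rewrite /bump leq0n add1n subn1 bin1 scalerA mulr_natr.
Qed.

(** The recursion [ucoefS] is the differential equation of phi^t = exp(t log phi), solved
    coefficient by coefficient. *)
Lemma ucoef_exp (V : lmodType K) (phi : {linear V -> V}) k (v : V) :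
  unipotent phi -> ucoef phi k v = (k`!%:R)^-1 *: iter k (ucoef phi 1) v.
Proof.
move=> phiU; elim: k => [|k IH] /=; first by rewrite ucoef0 invr1 scale1r.
have k0 : k.+1%:R != 0 :> K by rewrite pnatr_eq0.
rewrite -[LHS](scalerK k0) ucoefS // IH linearZ scalerA factS natrM invfM.
by rewrite mulrC.
Qed.

(** This is the expansion of phi^t read at t = 1. Linearity is a hypothesis on a bare function
    because the components of a [fam] are not bundled. *)
Lemma exp_log_unipotent (V : lmodType K) (phi : V -> V) (v : V) :
  linear phi -> unipotent phi ->
  phi v = \sum_(k < m.+1) (k`!%:R)^-1 *: iter k (ucoef phi 1) v.
Proof.
move=> phi_lin.
suff H (L : {linear V -> V}) : unipotent L ->
    L v = \sum_(k < m.+1) (k`!%:R)^-1 *: iter k (ucoef L 1) v.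
  exact: (H (HB.pack_for {linear V -> V} phi
               (GRing.isLinear.Build K V V *:%R phi phi_lin))).
move=> phiU; rewrite -[LHS]/(iter 1 L v) (iter_unipotent _ _ phiU (M := m.+1)) //.
by apply: eq_bigr => k _; rewrite expr1n scale1r ucoef_exp.
Qed.

(* Comparison of the coefficients of t in
   phi^t (b w v) = b (psi^t w) (phi^t v). *)
Lemma log_derivation (W V : lmodType K) (b : W -> V -> V)
    (psi : W -> W) (phi : V -> V) :
  (forall w, linear (b w)) -> (forall v, linear (b^~ v)) ->
  linear psi -> linear phi ->
  unipotent psi -> unipotent phi ->
  (forall (w : W) (v : V), phi (b w v) = b (psi w) (phi v)) ->
  forall (w : W) (v : V),
  ucoef phi 1 (b w v) = b (ucoef psi 1 w) v + b w (ucoef phi 1 v).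
Proof.
move=> bl br psi_lin phi_lin.
suff H (psiL : {linear W -> W}) (phiL : {linear V -> V}) :
    unipotent psiL -> unipotent phiL ->
    (forall (w : W) (v : V), phiL (b w v) = b (psiL w) (phiL v)) ->
    forall (w : W) (v : V),
    ucoef phiL 1 (b w v) = b (ucoef psiL 1 w) v + b w (ucoef phiL 1 v).
  exact: (H (HB.pack_for {linear W -> W} psi
               (GRing.isLinear.Build K W W *:%R psi psi_lin))
            (HB.pack_for {linear V -> V} phi
               (GRing.isLinear.Build K V V *:%R phi phi_lin))).
move: psiL phiL => {psi phi psi_lin phi_lin} psi phi psiU phiU phib w v.
have blZ x a y : b x (a *: y) = a *: b x y := linear_funZ (bl x) a y.
have brZ x a y : b (a *: x) y = a *: b x y := linear_funZ (br y) a x.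
have blS x (F : 'I_m.+2 -> V) : b x (\sum_i F i) = \sum_i b x (F i).
  exact: (linear_fun_sum (bl x)).
have brS y (F : 'I_m.+2 -> W) : b (\sum_i F i) y = \sum_i b (F i) y.
  exact: (linear_fun_sum (br y)).
(* The product of two polynomials in t with m + 2 coefficients each has fewer than [M] coefficients,
   and [c k] is its Cauchy coefficient. *)
pose M := (m.+2 + m.+2)%N.
pose c k := \sum_(i < m.+2) \sum_(j < m.+2)
   (i + j == k)%N%:R *: b (ucoef psi i w) (ucoef phi j v).
have iterb t : iter t phi (b w v) = b (iter t psi w) (iter t phi v).
  by elim: t => //= t ->; rewrite phib.
have -> : ucoef phi 1 (b w v) = c 1%N.
  apply: (@vpoly_coef K V M (fun k => ucoef phi k (b w v)) c) => // t.
  rewrite -(iter_unipotent t _ phiU); last by apply: leq_trans (leq_addr _ _).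
  rewrite iterb (iter_unipotent _ _ phiU (M := m.+2)) //.
  rewrite (iter_unipotent _ _ psiU (M := m.+2)) //.
  rewrite blS.
  under [RHS]eq_bigr do rewrite scaler_sumr.
  under [RHS]eq_bigr do under eq_bigr do rewrite scaler_sumr.
  rewrite exchange_big; under [RHS]eq_bigr do rewrite exchange_big.
  rewrite exchange_big; apply: eq_bigr => j _ /=.
  rewrite blZ brS scaler_sumr; apply: eq_bigr => i _.
  rewrite brZ scalerA -exprD.
  have ijM : (i + j < M)%N by rewrite /M -addSn leq_add // ltnW.
  rewrite (bigD1 (Ordinal ijM)) //= eqxx scale1r big1.
    by rewrite addr0 [(j + i)%N]addnC.
  move=> k.
  by rewrite -val_eqE /= eq_sym => /negPf ->; rewrite scale0r scaler0.
have zero (i : nat) : (1 < i)%N ->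
    \sum_(j < m.+2) (i + j == 1)%N%:R *: b (ucoef psi i w) (ucoef phi j v) = 0.
  by case: i => [|[|i]] // _; rewrite big1 // => j _; rewrite scale0r.
rewrite /c 2!big_ord_recl [X in _ + (_ + X)]big1 => [|i _]; last exact: zero.
rewrite !big_ord_recl /= !scale0r !scale1r !big1 => [|i _|i _]; rewrite ?scale0r //.
by rewrite !ucoef0 !addr0 add0r addrC.
Qed.

End Unipotent.

(** Membership in a power of J is witnessed by a finite family; adding two members concatenates
    their families, and [P] carries over the conditions on the entries. *)
Lemma sum_cat (K : numFieldType) (V : lmodType K) (T : Type) (F : T -> V)
    (N1 N2 : nat) (t1 : 'I_N1 -> T) (t2 : 'I_N2 -> T) :
  exists2 t : 'I_(N1 + N2) -> T,
    forall P : T -> Prop, (forall l, P (t1 l)) -> (forall l, P (t2 l)) ->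
      forall l, P (t l)
    & \sum_l F (t l) = \sum_l F (t1 l) + \sum_l F (t2 l).
Proof.
exists (fun l => match fintype.split l with inl i => t1 i | inr i => t2 i end).
  by move=> P P1 P2 l; case: (fintype.split l).
rewrite big_split_ord; congr (_ + _); apply: eq_bigr => i _.
  by rewrite (unsplitK (inl i)).
by rewrite (unsplitK (inr i)).
Qed.

(** * Local properties on open sets *)

Section LocallyOn.
Variable M : topologicalType.
Implicit Types (V W : set M) (P Q R : set M -> Prop).

Lemma locally_on_self V P : open V -> P V -> locally_on V P.
Proof. by move=> oV PV x Vx; exists V; split. Qed.

Lemma locally_on_bind V P Q : locally_on V P ->
  (forall W, open W -> W `<=` V -> P W -> locally_on W Q) -> locally_on V Q.
Proof.
move=> VP PQ x Vx; have [W [oW Wx WV PW]] := VP x Vx.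
have [X [oX Xx XW QX]] := PQ W oW WV PW x Wx.
by exists X; split => //; apply: subset_trans WV.
Qed.

Lemma locally_on_imp V P Q : locally_on V P ->
  (forall W, open W -> W `<=` V -> P W -> Q W) -> locally_on V Q.
Proof.
move=> VP PQ; apply: locally_on_bind VP _ => W oW WV PW.
by apply: locally_on_self => //; apply: PQ.
Qed.

Lemma locally_on_sub V V' P : open V' -> V' `<=` V -> locally_on V P ->
  (forall W W', open W -> open W' -> W `<=` V -> W' `<=` W -> P W -> P W') ->
  locally_on V' P.
Proof.
move=> oV' V'V VP PS x V'x; have [W [oW Wx WV PW]] := VP x (V'V _ V'x).
exists (W `&` V'); split => //; first exact: openI.
by apply: (PS W) => //; apply: openI.
Qed.

Lemma locally_on_and V P Q R : locally_on V P -> locally_on V Q ->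
  (forall W1 W2, open W1 -> open W2 -> W1 `<=` V -> W2 `<=` V -> P W1 -> Q W2 ->
     R (W1 `&` W2)) -> locally_on V R.
Proof.
move=> VP VQ PQR x Vx; have [W1 [oW1 W1x W1V PW1]] := VP x Vx.
have [W2 [oW2 W2x W2V QW2]] := VQ x Vx.
exists (W1 `&` W2); split => //; first exact: openI.
  by move=> y [/W1V].
exact: PQR.
Qed.

End LocallyOn.

Section Sheaves.
Variables (K : numFieldType) (M : topologicalType).

Lemma sheaf_eq (F : vsheaf K M) (V : set M) (s t : F V) : open V ->
  locally_on V (fun W => res V W s = res V W t) -> s = t.
Proof.
move=> oV st; apply/eqP; rewrite -subr_eq0; apply/eqP; apply: sheaf_sep => //.
by apply: locally_on_imp st _ => W _ _ e; rewrite linearB /= e subrr.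
Qed.

Variables (O : sasheaf K M) (E : msheaf O).

Section Action.
Variable V : set M.
Implicit Types (f : O V) (v : E V).

Lemma act_linear f : linear (@act K M O E V f).
Proof. by move=> a v w; apply: act_linr. Qed.

Lemma act_linearl v : linear (fun f => @act K M O E V f v).
Proof. by move=> a f g; apply: act_linl. Qed.

Lemma par_act b f v :
  par V b (act f v) = act (par V false f) (par V b v)
                      + act (par V true f) (par V (~~ b) v).
Proof.
rewrite -{1}(par_sum f) -{1}(par_sum v).
rewrite (linear_funD (act_linearl _)) !(linear_funD (act_linear _)) !linearD /=.
have P b1 b2 : par V b (act (par V b1 f) (par V b2 v)) =
    if b == b1 (+) b2 then act (par V b1 f) (par V b2 v) else 0.
  by rewrite -act_par par_proj; case: eqP => // ->.
by rewrite !P {P}; case: b => /=; rewrite ?addr0 ?add0r // addrC.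
Qed.

End Action.

End Sheaves.

Section Multiplication.
Variables (K : numFieldType) (M : topologicalType) (O : sasheaf K M) (V : set M).
Implicit Types f g : O V.

Lemma mul_linear f : linear (@mul K M O V f).
Proof. exact: (act_linear (E := reg O)). Qed.

Lemma mul_linearl g : linear (fun f => @mul K M O V f g).
Proof. exact: (act_linearl (E := reg O)). Qed.

Lemma par_mul b f g :
  par V b (mul f g) = mul (par V false f) (par V b g)
                      + mul (par V true f) (par V (~~ b) g).
Proof. exact: (par_act (E := reg O)). Qed.

End Multiplication.

Local Arguments filt : simpl never.

(** * The filtration of a module by the powers of J *)

Section Filtration.
Variables (K : numFieldType) (M : topologicalType).
Variables (O : sasheaf K M) (E : msheaf O).

Lemma inJ_res (V W : set M) (f : O V) : open V -> open W -> W `<=` V ->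
  inJ f -> inJ (res V W f).
Proof.
move=> oV oW WV Jf.
suff: locally_on W (fun X => exists N (g h : 'I_N -> O X),
    res V X f = \sum_l mul (g l) (par X true (h l))).
  move/locally_on_imp; apply => X oX XW [N [g [h e]]].
  by exists N, g, h; rewrite res_comp.
apply: (locally_on_sub oW WV Jf) => X Y oX oY XV YX [N [g [h e]]].
exists N, (fun l => res X Y (g l)), (fun l => res X Y (h l)).
rewrite -(res_comp f oV oX oY XV YX) e linear_sum; apply: eq_bigr => l _.
by rewrite /= res_mul // par_res.
Qed.

Lemma inJ_par (V : set M) b (f : O V) : open V -> inJ f -> inJ (par V b f).
Proof.
move=> oV Jf; apply: locally_on_imp Jf _ => W oW WV [N [g [h e]]].
exists N, (fun l => par W (~~ b) (g l)), h.
rewrite -par_res // e linear_sum; apply: eq_bigr => l _ /=.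
rewrite par_mul !par_proj.
by case: b => /=; rewrite (linear_fun0 (mul_linear _)) ?addr0 ?add0r.
Qed.

Lemma inJ_mul (V : set M) (f g : O V) : open V -> inJ g -> inJ (mul f g).
Proof.
move=> oV Jg; apply: locally_on_imp Jg _ => W oW WV [N [g' [h e]]].
exists N, (fun l => mul (res V W f) (g' l)), h.
rewrite res_mul // e (linear_fun_sum (mul_linear _)).
by apply: eq_bigr => l _; rewrite -mul_assoc.
Qed.

Lemma inJ_odd (V : set M) (f : O V) : open V -> inJ (par V true f).
Proof.
move=> oV; apply: locally_on_self => //; exists 1%N, (fun=> one O V), (fun=> f).
by rewrite big_ord1 res_id // mul_onel.
Qed.

Lemma filt_local p (V : set M) (e : E V) : open V ->
  locally_on V (fun W => filt p (res V W e)) -> filt p e.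
Proof.
case: p => // p oV loc; apply: locally_on_bind loc _ => W oW WV loc.
apply: locally_on_imp loc _ => X oX XW [N [f [e' [h eq]]]].
by exists N, f, e'; rewrite res_comp in eq.
Qed.

Lemma filt_res p (V W : set M) (e : E V) : open V -> open W -> W `<=` V ->
  filt p e -> filt p (res V W e).
Proof.
elim: p V W e => // p IH V W e oV oW WV Fe.
suff: locally_on W (fun X => exists N (f : 'I_N -> O X) (e' : 'I_N -> E X),
    (forall l, inJ (f l) /\ filt p (e' l)) /\ res V X e = \sum_l act (f l) (e' l)).
  move/locally_on_imp; apply => X oX XW [N [f [e' [h eq]]]].
  by exists N, f, e'; rewrite res_comp.
apply: (locally_on_sub oW WV Fe) => X Y oX oY XV YX [N [f [e' [h eq]]]].
exists N, (fun l => res X Y (f l)), (fun l => res X Y (e' l)); split.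
  by move=> l; have [? ?] := h l; split; [apply: inJ_res|apply: IH].
rewrite -(res_comp e oV oX oY XV YX) eq linear_sum; apply: eq_bigr => l _.
by rewrite /= res_act.
Qed.

Lemma filt0 p (V : set M) : open V -> filt p (0 : E V).
Proof.
case: p => // p oV; apply: locally_on_self => //.
exists 0%N, (fun=> 0), (fun=> 0); split; first by case.
by rewrite linear0 big_ord0.
Qed.

Lemma filt_linear p (V : set M) a (e e' : E V) : open V ->
  filt p e -> filt p e' -> filt p (a *: e + e').
Proof.
elim: p V e e' => // p IH V e e' oV Fe Fe'.
apply: (locally_on_and Fe Fe') => W1 W2 oW1 oW2 W1V W2V.
move=> [N1 [f1 [e1 [h1 eq1]]]] [N2 [f2 [e2 [h2 eq2]]]].
pose W := W1 `&` W2; have oW : open W by apply: openI.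
have WW1 : W `<=` W1 by move=> x [].
have WW2 : W `<=` W2 by move=> x [].
have [t tP tE] := sum_cat (fun u : O W * E W => act u.1 u.2)
  (fun l => (res W1 W (f1 l), a *: res W1 W (e1 l)))
  (fun l => (res W2 W (f2 l), res W2 W (e2 l))).
exists (N1 + N2)%N, (fun l => (t l).1), (fun l => (t l).2); split.
  apply: (tP (fun u => inJ u.1 /\ filt p u.2)) => l /=.
    have [? ?] := h1 l; split; first exact: inJ_res.
    rewrite -[_ *: _]addr0; apply: IH => //; first exact: filt_res.
    exact: filt0.
  by have [? ?] := h2 l; split; [apply: inJ_res|apply: filt_res].
rewrite tE linearP /= -(res_comp e oV oW1 oW W1V WW1) eq1.
rewrite -(res_comp e' oV oW2 oW W2V WW2) eq2.
rewrite (linear_sum (res W1 W)) (linear_sum (res W2 W)) scaler_sumr.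
congr (_ + _); apply: eq_bigr => l _ /=; rewrite res_act //.
by rewrite (linear_funZ (act_linear _)).
Qed.

Lemma filt_sum p (V : set M) (I : Type) (r : seq I) (F : I -> E V) : open V ->
  (forall i, filt p (F i)) -> filt p (\sum_(i <- r) F i).
Proof.
move=> oV FF; elim/big_ind: _ => //; first exact: filt0.
by move=> e e' Fe Fe'; rewrite -[e]scale1r; apply: filt_linear.
Qed.

Lemma filtD p (V : set M) (e e' : E V) : open V ->
  filt p e -> filt p e' -> filt p (e + e').
Proof. by move=> oV Fe Fe'; rewrite -[e]scale1r; apply: filt_linear. Qed.

Lemma filt_mono p q (V : set M) (e : E V) : open V -> (p <= q)%N ->
  filt q e -> filt p e.
Proof.
elim: q p V e => [|q IH] [|p] V e oV // pq Fe.
apply: locally_on_imp Fe _ => W oW WV [N [f [e' [h eq]]]].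
exists N, f, e'; split=> // l; have [? ?] := h l; split => //; exact: IH.
Qed.

Lemma filt_act1 p (V : set M) (f : O V) (e : E V) : open V ->
  inJ f -> filt p e -> filt p.+1 (act f e).
Proof.
move=> oV Jf Fe; apply: locally_on_self => //.
by exists 1%N, (fun=> f), (fun=> e); rewrite big_ord1 res_id.
Qed.

Lemma filt_act0 p (V : set M) (f : O V) (e : E V) : open V ->
  filt p e -> filt p (act f e).
Proof.
case: p => // p oV Fe; apply: locally_on_imp Fe _ => W oW WV [N [g [e' [h eq]]]].
exists N, (fun l => mul (res V W f) (g l)), e'; split.
  by move=> l; have [? ?] := h l; split => //; apply: inJ_mul.
rewrite res_act // eq (linear_fun_sum (act_linear _)).
by apply: eq_bigr => l _; rewrite act_assoc.
Qed.

Lemma filt_par p (V : set M) b (e : E V) : open V ->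
  filt p e -> filt p (par V b e).
Proof.
elim: p V b e => // p IH V b e oV Fe.
apply: filt_local => //; apply: locally_on_imp Fe _.
move=> W oW WV [N [f [e' [h eq]]]].
rewrite -par_res // eq linear_sum; apply: filt_sum => // l /=.
rewrite par_act; have [? ?] := h l.
by apply: filtD => //; apply: filt_act1 => //;
  [apply: inJ_par|apply: IH|apply: inJ_par|apply: IH].
Qed.

End Filtration.

Section FiltrationProduct.
Variables (K : numFieldType) (M : topologicalType).
Variables (O : sasheaf K M) (E : msheaf O).

Lemma filt_act p q (V : set M) (f : O V) (e : E V) : open V ->
  filt (E := reg O) p f -> filt q e -> filt (p + q) (act f e).
Proof.
elim: p V f e => [|p IH] V f e oV Ff Fe; first exact: filt_act0.
apply: filt_local => //; apply: locally_on_imp Ff _.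
move=> W oW WV [N [g [f' [h eq]]]].
rewrite res_act // eq (linear_fun_sum (act_linearl _)).
apply: filt_sum => // l; have [? ?] := h l.
rewrite -(act_assoc (g l)) addSn; apply: filt_act1 => //.
by apply: IH => //; apply: filt_res.
Qed.

End FiltrationProduct.

(** * Parity and the powers of J *)

Section Parity.
Variables (K : numFieldType) (M : topologicalType) (O : sasheaf K M).

Lemma filt_odd (V : set M) (f : O V) : open V ->
  filt (E := reg O) 1 (par V true f).
Proof.
move=> oV; rewrite -(mul_oner (par V true f)).
by apply: (filt_act1 (E := reg O)) => //; apply: inJ_odd.
Qed.

(** In a product g f' with g in J, the wrong parity arises in two ways: from the even part of g,
    which lies in J^2 because its odd generators then have odd coefficients, or from the wrong
    parity of f', to which induction applies. *)
Lemma filt_parity p (V : set M) (f : O V) : open V ->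
  filt (E := reg O) p f -> filt (E := reg O) p.+1 (par V (~~ odd p) f).
Proof.
elim: p V f => [|p IH] V f oV Ff; first exact: filt_odd.
apply: filt_local => //; apply: locally_on_imp Ff _.
move=> W oW WV [N [g [f' [h eq]]]].
rewrite -par_res // eq linear_sum; apply: filt_sum => // l /=.
have [Jg Ff'] := h l; rewrite negbK [X in filt _ X]par_mul; apply: filtD => //.
  apply: (filt_act (E := reg O) (p := 2)) => //; last exact: filt_par.
  apply: filt_local => //; apply: locally_on_imp Jg _.
  move=> X oX XW [N' [a [b eq']]].
  rewrite -par_res // eq' linear_sum; apply: filt_sum => // i /=.
  rewrite par_mul !par_proj /= (linear_fun0 (mul_linear _)) add0r.
  by apply: (filt_act1 (E := reg O)) => //; [apply: inJ_odd|apply: filt_odd].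
by apply: (filt_act1 (E := reg O)) => //; [apply: inJ_par|apply: IH].
Qed.

End Parity.

(** * The graded sheaf and its filtration by degree *)

Section Graded.
Variables (K : numFieldType) (M : topologicalType).
Variables (O : sasheaf K M) (E : msheaf O) (G : vsheaf K M).
Variables (pr : nat -> forall V, {linear G V -> G V}) (pi : nat -> fam E G).
Hypothesis grG : is_gr pr pi.
Implicit Types V W : set M.

(** The number of nonzero components is bounded only locally, by a bound depending on the section;
    hence the passage to a common neighbourhood and the padding to the larger of the two bounds. *)
Lemma pr_ext V (v w : G V) : open V ->
  (forall q, pr q V v = pr q V w) -> v = w.
Proof.
move=> oV vw; apply: sheaf_eq => //.
apply: (locally_on_and (gr_pr_sum grG v oV) (gr_pr_sum grG w oV)).
move=> W1 W2 oW1 oW2 W1V W2V [N1 e1] [N2 e2].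
pose W := W1 `&` W2; have oW : open W by apply: openI.
have WW1 : W `<=` W1 by move=> x [].
have WW2 : W `<=` W2 by move=> x [].
have WV : W `<=` V by apply: subset_trans W1V.
have sumE W' N (u : G V) : open W' -> W' `<=` V -> W `<=` W' ->
    res V W' u = \sum_(q < N) pr q W' (res V W' u) ->
    forall N', (N <= N')%N -> res V W u = \sum_(q < N') res V W (pr q V u).
  move=> oW' W'V WW' e N' NN'.
  have prE q : pr q W (res V W u) = res V W (pr q V u) by apply: (gr_pr_res grG).
  have eN : res V W u = \sum_(q < N) pr q W (res V W u).
    rewrite -(res_comp u oV oW' oW W'V WW') {1}e linear_sum.
    by apply: eq_bigr => q _; rewrite /= -(gr_pr_res grG).
  have out q : (N <= q)%N -> pr q W (res V W u) = 0.
    move=> Nq; rewrite eN linear_sum big1 // => i _ /=.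
    by rewrite (gr_pr_proj grG) gtn_eqF // (leq_trans (ltn_ord i)).
  rewrite eN (big_ord_widen _ (fun q => pr q W (res V W u)) NN') big_mkcond.
  apply: eq_bigr => q _; rewrite -prE.
  by case: ltnP => // Nq; rewrite out.
rewrite (sumE _ _ v oW1 W1V WW1 e1 (maxn N1 N2) (leq_maxl _ _)).
rewrite (sumE _ _ w oW2 W2V WW2 e2 (maxn N1 N2) (leq_maxr _ _)).
by apply: eq_bigr => q _; rewrite vw.
Qed.

Lemma gfilt_linear p V a (v w : G V) :
  gfilt pr p v -> gfilt pr p w -> gfilt pr p (a *: v + w).
Proof. by move=> Fv Fw r rp; rewrite linearP /= Fv // Fw // scaler0 addr0. Qed.

Lemma gfilt0 p V : gfilt pr p (0 : G V).
Proof. by move=> r _; rewrite linear0. Qed.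

Lemma gfiltD p V (v w : G V) :
  gfilt pr p v -> gfilt pr p w -> gfilt pr p (v + w).
Proof. by move=> Fv Fw; rewrite -[v]scale1r; apply: gfilt_linear. Qed.

Lemma gfiltB p V (v w : G V) :
  gfilt pr p v -> gfilt pr p w -> gfilt pr p (v - w).
Proof. by move=> Fv Fw; rewrite addrC -scaleN1r; apply: gfilt_linear. Qed.

Lemma gfiltZ p V a (v : G V) : gfilt pr p v -> gfilt pr p (a *: v).
Proof. by move=> Fv; rewrite -[_ *: _]addr0; apply/gfilt_linear/gfilt0. Qed.

Lemma gfilt_sum p V (I : Type) (r : seq I) (P : pred I) (F : I -> G V) :
  (forall i, P i -> gfilt pr p (F i)) -> gfilt pr p (\sum_(i <- r | P i) F i).
Proof.
by move=> FF; elim/big_ind: _ => //; [apply: gfilt0|move=> *; apply: gfiltD].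
Qed.

Lemma gfilt_mono p q V (v : G V) : (p <= q)%N -> gfilt pr q v -> gfilt pr p v.
Proof. by move=> pq Fv r rp; apply: Fv; apply: leq_trans pq. Qed.

Lemma gfilt_res p V W (v : G V) : open V -> open W -> W `<=` V ->
  gfilt pr p v -> gfilt pr p (res V W v).
Proof. by move=> oV oW WV Fv r rp; rewrite (gr_pr_res grG) // Fv // linear0. Qed.

Lemma gfilt_local p V (v : G V) : open V ->
  locally_on V (fun W => gfilt pr p (res V W v)) -> gfilt pr p v.
Proof.
move=> oV loc r rp; apply: sheaf_sep => //.
apply: locally_on_imp loc _ => W oW WV Fv.
by rewrite -(gr_pr_res grG) // Fv.
Qed.

Lemma gfilt_pr p V (v : G V) : gfilt pr p (pr p V v).
Proof. by move=> r rp; rewrite (gr_pr_proj grG) ltn_eqF. Qed.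

Lemma gfiltS p V (v : G V) : gfilt pr p v -> pr p V v = 0 -> gfilt pr p.+1 v.
Proof. by move=> Fv pv r; rewrite ltnS leq_eqVlt => /predU1P[->|/Fv]. Qed.

Lemma gfilt_trunc p V (v : G V) : gfilt pr p (v - \sum_(q < p) pr q V v).
Proof.
move=> r rp; rewrite linearB linear_sum (bigD1 (Ordinal rp)) //= big1 => [|i].
  by rewrite (gr_pr_proj grG) eqxx addr0 subrr.
by rewrite -val_eqE /= (gr_pr_proj grG) eq_sym => /negPf ->.
Qed.

Lemma pi0 p V : open V -> pi p (0 : E V) = 0.
Proof.
by move=> oV; apply/(gr_pi_ker grG) => //; apply: filt0.
Qed.

Lemma pi_sum p V (N : nat) (F : 'I_N -> E V) : open V ->
  (forall l, filt p (F l)) -> pi p (\sum_l F l) = \sum_l pi p (F l).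
Proof.
move=> oV; elim: N F => [|N IH] F FF; first by rewrite !big_ord0 pi0.
rewrite !big_ord_recl -[F ord0]scale1r (gr_pi_lin grG) ?scale1r ?IH //.
exact: filt_sum.
Qed.

Section Nilpotent.
Variable m : nat.
Hypothesis nilE : forall V (e : E V), open V -> filt m.+1 e -> e = 0.

Lemma pr_out p V (v : G V) : open V -> (m < p)%N -> pr p V v = 0.
Proof.
move=> oV mp; apply: sheaf_sep => //.
have prv : pr p V (pr p V v) = pr p V v by rewrite (gr_pr_proj grG) eqxx.
apply: locally_on_imp (gr_pi_surj grG oV prv) _ => W oW WV [e Fe <-].
by rewrite (nilE oW (filt_mono oW mp Fe)) pi0.
Qed.

Lemma pr_sum V (v : G V) : open V -> v = \sum_(q < m.+1) pr q V v.
Proof.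
move=> oV; apply: pr_ext => // p; rewrite linear_sum.
have [pm|mp] := ltnP p m.+1.
  rewrite (bigD1 (Ordinal pm)) //= big1 => [|i].
    by rewrite (gr_pr_proj grG) eqxx addr0.
  by rewrite -val_eqE /= (gr_pr_proj grG) eq_sym => /negPf ->.
rewrite pr_out // big1 // => i _ /=.
by rewrite (gr_pr_proj grG) gtn_eqF // (leq_trans (ltn_ord i)).
Qed.

Lemma gfilt_nil V (v : G V) : open V -> gfilt pr m.+1 v -> v = 0.
Proof.
by move=> oV Fv; rewrite (pr_sum v oV) big1 // => i _; rewrite Fv.
Qed.

End Nilpotent.

(** For the converse, a section of J^p E whose image has no component of degree p has class 0 in gr
    E_p, hence lies in J^(p+1) E. The filtration of E can thus be tested on images in gr E. *)
Lemma filt_induces_id (U : set M) (phi : fam E G) p V (e : E V) :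
  induces_id pr pi U phi -> open V -> V `<=` U ->
  filt p e <-> gfilt pr p (phi V e).
Proof.
move=> phiP oV VU; split; first by move=> Fe; have [] := phiP p V e oV VU Fe.
elim: p => // p IH Fe.
have Fpe : filt p e by apply: IH; apply: gfilt_mono Fe.
have [_ prE] := phiP p V e oV VU Fpe.
by apply/(gr_pi_ker grG oV Fpe); rewrite -prE Fe.
Qed.

End Graded.

(** * Vanishing of J^(m+1) E *)

Section Nilpotency.
Variables (K : numFieldType) (M : topologicalType) (n m : nat).
Variable O : sasheaf K M.

Section Chart.
Variables (U : set M) (phi : M -> 'rV[K]_n).
Variable theta : forall V, O V -> @superfun K n m.
Hypothesis chart : is_chart U phi theta.

Lemma chart_linear_at V I z : open V -> V `<=` U -> (phi @` V) z ->
  linear (fun f : O V => theta f I z : K^o).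
Proof. by move=> oV VU Vz a f g; apply: (chart_lin chart). Qed.

Lemma chart_sum V (N : nat) (F : 'I_N -> O V) I z :
  open V -> V `<=` U -> (phi @` V) z ->
  theta (\sum_l F l) I z = \sum_l theta (F l) I z.
Proof.
by move=> oV VU Vz; rewrite (linear_fun_sum (chart_linear_at I oV VU Vz)).
Qed.

Lemma chart_inJ V (f : O V) z : open V -> V `<=` U -> (phi @` V) z ->
  inJ f -> theta f finset.set0 z = 0.
Proof.
move=> oV VU [x Vx <-] Jf; have [W [oW Wx WV [N [g [h e]]]]] := Jf x Vx.
have WU := subset_trans WV VU.
have Wz : (phi @` W) (phi x) by exists x.
rewrite -(chart_res chart f _ oV VU oW WV Wz) e chart_sum // big1 // => l _.
rewrite (chart_mul chart) // /smul big1 // => I; rewrite finset.subset0 => /eqP ->.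
rewrite finset.setD0 (chart_par chart) // finset.cards0 /=.
by rewrite mulr0.
Qed.

Variables (p0 q0 : nat) (E : msheaf O).
Variable U' : set M.
Hypothesis U'U : U' `<=` U.
Variable tau : forall V, ('I_p0 + 'I_q0 -> O V) -> E V.
Hypothesis tau_bij : forall V, open V -> V `<=` U' -> bijective (@tau V).
Hypothesis tau_linear : forall V a g h, open V -> V `<=` U' ->
  @tau V (fun l => a *: g l + h l) = a *: @tau V g + @tau V h.
Hypothesis tau_act : forall V f g, open V -> V `<=` U' ->
  @tau V (fun l => mul f (g l)) = act f (@tau V g).
Hypothesis tau_res : forall V W g, open V -> V `<=` U' -> open W -> W `<=` V ->
  @tau W (fun l => res V W (g l)) = res V W (@tau V g).

Lemma trivial0 V : open V -> V `<=` U' -> @tau V (fun=> 0) = 0.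
Proof.
move=> oV VU'; have := tau_linear 1 (fun=> 0) (fun=> 0) oV VU'.
rewrite !scale1r; under eq_fun do rewrite addr0.
by move/eqP; rewrite -subr_eq0 opprD addrA subrr sub0r oppr_eq0 => /eqP.
Qed.

Lemma trivial_sum V (N : nat) (g : 'I_N -> 'I_p0 + 'I_q0 -> O V) :
  open V -> V `<=` U' ->
  @tau V (fun l => \sum_i g i l) = \sum_i @tau V (g i).
Proof.
move=> oV VU'; elim: N g => [|N IH] g.
  by rewrite big_ord0; under eq_fun do rewrite big_ord0; apply: trivial0.
rewrite big_ord_recl; under eq_fun do rewrite big_ord_recl -[X in X + _]scale1r.
by rewrite tau_linear // scale1r IH.
Qed.

(** In the coefficient at I of a product f g with f in J, the term that takes the empty set from f
    vanishes, and every other term leaves to g a strictly smaller subset of I, to which induction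
    applies. *)
Lemma filt_trivial p V (g : 'I_p0 + 'I_q0 -> O V) (l : 'I_p0 + 'I_q0)
    (I : {set 'I_m}) z : open V -> V `<=` U' -> (phi @` V) z ->
  filt p (@tau V g) -> (#|I| < p)%N -> theta (g l) I z = 0.
Proof.
elim: p V g l I z => // p IH V g l I z oV VU' [x Vx <-] Fg Ip.
have [W [oW Wx WV [N [f [e [h eq]]]]]] := Fg x Vx.
have VU := subset_trans VU' U'U.
have WU' := subset_trans WV VU'; have WU := subset_trans WU' U'U.
have Wz : (phi @` W) (phi x) by exists x.
have /choice[g' g'P] : forall i, exists g', e i = @tau W g'.
  by move=> i; have [t _ tK] := tau_bij oW WU'; exists (t (e i)).
have gE l' : res V W (g l') = \sum_i mul (f i) (g' i l').
  suff: (fun l' => res V W (g l')) = (fun l' => \sum_i mul (f i) (g' i l')).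
    by move/(congr1 (@^~ l')).
  apply: (bij_inj (tau_bij oW WU')); rewrite tau_res // eq trivial_sum //.
  by apply: eq_bigr => i _; rewrite tau_act // g'P.
rewrite -(chart_res chart (g l) _ oV VU oW WV Wz) gE chart_sum // big1 // => i _.
have [Jf Fe] := h i.
rewrite (chart_mul chart) // /smul big1 // => J JI.
have [->|J0] := eqVneq J finset.set0; first by rewrite chart_inJ // mulr0 mul0r.
rewrite (IH W (g' i)) ?mulr0 // -?g'P //.
rewrite -ltnS (leq_trans _ Ip) // ltnS.
rewrite finset.cardsDS // ltn_subrL finset.card_gt0 J0.
by rewrite (leq_trans _ (subset_leq_card JI)) ?finset.card_gt0.
Qed.

(** Subsets of 'I_m have at most m elements, so p = m + 1 leaves no coefficient. *)
Lemma filt_nilpotent_trivial V (e : E V) : open V -> V `<=` U' ->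
  filt m.+1 e -> e = 0.
Proof.
move=> oV VU' Fe; have [t _ tK] := tau_bij oV VU'.
rewrite -(tK e) -(trivial0 oV VU'); congr (@tau V); apply/funext => l.
apply: (chart_injective chart oV (subset_trans VU' U'U)) => I z Vz.
apply: (filt_trivial (p := m.+1) l oV VU' Vz); rewrite ?tK //.
by rewrite ltnS -[X in (_ <= X)%N]card_ord max_card.
Qed.

End Chart.

Hypothesis hO : supermanifold n m O.

Lemma filt_nilpotent p0 q0 (E : msheaf O) V (e : E V) :
  locally_free p0 q0 E -> open V -> filt m.+1 e -> e = 0.
Proof.
move=> hE oV Fe; apply: sheaf_sep => // x Vx.
have [U1 [oU1 U1x _ [phi [theta chart]]]] := hO (Logic.I : setT x).
have [U2 [oU2 U2x _ [tau tauP]]] := hE x Logic.I.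
pose W := V `&` U1 `&` U2.
have oW : open W by do 2?apply: openI.
have WV : W `<=` V by move=> y [[]].
have WU1 : W `<=` U1 by move=> y [[]].
have WU2 : W `<=` U2 by move=> y [].
exists W; split=> //.
apply: (filt_nilpotent_trivial chart WU1 (tau := tau) (U' := W)) => //.
- by move=> X oX /subset_trans /(_ WU2) /(tauP X oX)[].
- by move=> X a g h oX /subset_trans /(_ WU2) /(tauP X oX)[].
- by move=> X f g oX /subset_trans /(_ WU2) /(tauP X oX)[].
- by move=> X Y g oX /subset_trans /(_ WU2) /(tauP X oX)[] ? ? ? ?; apply.
exact: filt_res.
Qed.

Lemma reg_locally_free : locally_free 1 0 (reg O).
Proof.
move=> x _; exists setT; split=> //; first exact: openT.
exists (fun V g => g (inl ord0)) => V oV _; split => //.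
exists (fun f l => f) => // g; apply/funext => -[i|[]//].
by rewrite (ord1 i).
Qed.

End Nilpotency.

(** * Automorphisms of gr O congruent to the identity modulo degree 2 *)

Section GradedAlgebra.
Variables (K : numFieldType) (M : topologicalType) (m : nat).
Variables (O : sasheaf K M) (GO : gralg O).
Hypothesis nilO : forall V (f : O V), open V -> filt (E := reg O) m.+1 f -> f = 0.
Implicit Types V W : set M.

Local Notation prO := (ga_pr GO).
Local Notation grO := (ga_gr GO).

Lemma gr_parity p V (f : GO V) : open V -> prO p V f = f ->
  par V (~~ odd p) f = 0.
Proof.
move=> oV prf; apply: sheaf_sep => //.
apply: locally_on_imp (gr_pi_surj grO oV prf) _ => W oW WV [e Fe piE].
rewrite -par_res // -piE -(gr_pi_par grO _ oW Fe).
by apply/(gr_pi_ker grO oW (filt_par _ oW Fe)); apply: filt_parity.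
Qed.

Lemma mul_homogeneous p q V (f g : GO V) : open V ->
  prO p V f = f -> prO q V g = g -> prO (p + q) V (mul f g) = mul f g.
Proof.
move=> oV prf prg; apply: sheaf_eq => //.
apply: (locally_on_and (gr_pi_surj grO oV prf) (gr_pi_surj grO oV prg)).
move=> W1 W2 oW1 oW2 W1V W2V [a Fa aE] [b Fb bE].
pose W := W1 `&` W2; have oW : open W by apply: openI.
have WW1 : W `<=` W1 by move=> x [].
have WW2 : W `<=` W2 by move=> x [].
have WV : W `<=` V by apply: subset_trans W1V.
rewrite -(gr_pr_res grO) // !res_mul //.
rewrite -(res_comp f oV oW1 oW W1V WW1) -(res_comp g oV oW2 oW W2V WW2) -aE -bE.
rewrite -(gr_pi_res grO) // -(gr_pi_res grO) //.
have Fa' := filt_res oW1 oW WW1 Fa; have Fb' := filt_res oW2 oW WW2 Fb.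
rewrite ga_mul // (gr_pi_pr grO) //.
exact: (filt_act (E := reg O)).
Qed.

Lemma gfilt_mul p q V (f g : GO V) : open V ->
  gfilt prO p f -> gfilt prO q g -> gfilt prO (p + q) (mul f g).
Proof.
move=> oV Ff Fg.
rewrite (pr_sum grO nilO f oV) (pr_sum grO nilO g oV).
rewrite (linear_fun_sum (mul_linearl _)); apply: gfilt_sum => i _.
rewrite (linear_fun_sum (mul_linear _)); apply: gfilt_sum => j _.
have [ip|pi] := ltnP i p.
  by rewrite Ff // (linear_fun0 (mul_linearl _)); apply: gfilt0.
have [jq|qj] := ltnP j q.
  by rewrite Fg // (linear_fun0 (mul_linear _)); apply: gfilt0.
rewrite -(@mul_homogeneous i j) ?(gr_pr_proj grO) ?eqxx //.
by apply: (gfilt_mono (leq_add pi qj)); apply: (gfilt_pr grO).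
Qed.

Section Congruent.
Variables (U : set M) (Psi : fam GO GO).
Hypothesis PsiP : is_alg_iso U Psi.
Hypothesis Psi2 : forall V f, open V -> V `<=` U -> gfilt prO 2 (Psi f - f : GO V).

Let Psi_linear V : open V -> V `<=` U -> linear (@Psi V).
Proof. by move=> oV VU a f g; have [+ _ _] := (PsiP.1).1 V oV VU; apply. Qed.

Let Psi_res V W f : open V -> V `<=` U -> open W -> W `<=` V ->
  Psi (res V W f) = res V W (Psi f).
Proof. by move=> oV VU oW WV; have [_ _ ->] := (PsiP.1).1 V oV VU. Qed.

(* Psi - id raises degrees by 2 already in degree 1: it preserves the parity,
   and the odd part of gr O_2 is zero. *)
Let raise1 V (f : GO V) : open V -> V `<=` U -> prO 1 V f = f ->
  gfilt prO 3 (Psi f - f).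
Proof.
move=> oV VU prf; apply: gfiltS; first exact: Psi2.
have f1 : par V true f = f.
  by rewrite -[RHS](par_sum f) (gr_parity (p := 1) oV prf) add0r.
have [_ Ppar _] := (PsiP.1).1 V oV VU.
set w := Psi f - f.
have w1 : par V true w = w by rewrite linearB /= -Ppar f1.
rewrite -w1 (gr_pr_par grO); apply: (gr_parity (p := 2)) => //.
by rewrite (gr_pr_proj grO).
Qed.

(** A class of degree p + 1 is locally a sum of products a b of classes of degrees 1 and p. In Psi a
    Psi b - a b = (Psi a - a) Psi b + a (Psi b - b) the first term gains 2 by [raise1] and the
    second by induction. *)
Let raise_pi p V (e : O V) : open V -> V `<=` U -> filt (E := reg O) p e ->
  gfilt prO p.+2 (Psi (ga_pi GO p e) - ga_pi GO p e).
Proof.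
elim: p V e => [|p IH] V e oV VU Fe; first exact: Psi2.
apply: (gfilt_local grO) => //; apply: locally_on_imp (Fe) _.
move=> W oW WV [N [f [e' [h eq]]]].
have WU := subset_trans WV VU.
have Ff l : filt (E := reg O) 1 (f l).
  rewrite -(mul_oner (f l)); apply: (filt_act1 (E := reg O)) => //.
  by have [] := h l.
have Fe' l : filt (E := reg O) p (e' l) by have [] := h l.
have Ffe l : filt (E := reg O) p.+1 (mul (f l) (e' l)).
  by apply: (filt_act (E := reg O) (p := 1)).
have piE : res V W (ga_pi GO p.+1 e) =
    \sum_l mul (ga_pi GO 1 (f l)) (ga_pi GO p (e' l)).
  rewrite -(gr_pi_res grO) //.
  transitivity (ga_pi GO p.+1 (\sum_l mul (f l) (e' l))); first exact: congr1.
  transitivity (\sum_l ga_pi GO p.+1 (mul (f l) (e' l))).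
    exact: (pi_sum grO).
  by apply: eq_bigr => l _; rewrite (ga_mul GO (p := 1)).
rewrite linearB /= -Psi_res // piE (linear_fun_sum (Psi_linear oW WU)) -sumrB.
apply: gfilt_sum => l _; have [_ /(_ W oW WU)[-> _]] := PsiP.
set a := ga_pi GO 1 (f l); set b := ga_pi GO p (e' l).
have -> : mul (Psi a) (Psi b) - mul a b =
    mul (Psi a - a) (Psi b) + mul a (Psi b - b).
  rewrite (linear_funB (mul_linear _)) (linear_funB (mul_linearl _)).
  by rewrite addrA subrK.
have pra : prO 1 W a = a by rewrite (gr_pi_pr grO).
have prb : prO p W b = b by rewrite (gr_pi_pr grO).
have Fa : gfilt prO 1 a by rewrite -pra; apply: (gfilt_pr grO).
have Fb : gfilt prO p b by rewrite -prb; apply: (gfilt_pr grO).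
have FPb : gfilt prO p.+2 (Psi b - b) by apply: IH.
apply: gfiltD; last by apply: (@gfilt_mul 1 p.+2).
rewrite -[p.+3]/(3 + p)%N; apply: gfilt_mul => //; first exact: raise1.
rewrite -[Psi b](subrK b); apply: gfiltD => //.
by apply: gfilt_mono FPb; rewrite -addn2 leq_addr.
Qed.

(** This turns the congruence that [QAut] imposes on Psi into the filtered form that [QDer12]
    requires of the derivation. *)
Lemma gfilt_alg_iso r V (f : GO V) : open V -> V `<=` U ->
  gfilt prO r f -> gfilt prO r.+2 (Psi f - f).
Proof.
move=> oV VU Ff; rewrite {1 2}(pr_sum grO nilO f oV).
rewrite (linear_fun_sum (Psi_linear oV VU)) -sumrB; apply: gfilt_sum => q _.
have [qr|rq] := ltnP q r.
  by rewrite Ff // (linear_fun0 (Psi_linear oV VU)) subrr; apply: gfilt0.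
apply: (@gfilt_mono _ _ _ _ _ q.+2) => //.
have prq : prO q V (prO q V f) = prO q V f by rewrite (gr_pr_proj grO) eqxx.
apply: (gfilt_local grO) => //; apply: locally_on_imp (gr_pi_surj grO oV prq) _.
move=> W oW WV [e Fe piE].
rewrite linearB /= -Psi_res // -piE; apply: raise_pi => //.
exact: subset_trans VU.
Qed.

End Congruent.
End GradedAlgebra.

(** * Naturality and degree of the logarithm *)

Section Logarithm.
Variables (K : numFieldType) (m : nat).

Lemma iter_dev_morph (V V' : lmodType K) (phi : V -> V) (phi' : V' -> V')
    (L : {linear V -> V'}) j v :
  (forall v, L (phi v) = phi' (L v)) ->
  L (iter j (dev phi) v) = iter j (dev phi') (L v).
Proof. by move=> Lphi; elim: j => //= j IH; rewrite /dev linearB /= Lphi IH. Qed.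

(** [ucoef] is a polynomial in phi, hence natural; with [L] a restriction or a parity projection,
    this makes the logarithm a morphism of graded sheaves. *)
Lemma ucoef_morph (V V' : lmodType K) (phi : V -> V) (phi' : V' -> V')
    (L : {linear V -> V'}) k v :
  (forall v, L (phi v) = phi' (L v)) ->
  L (ucoef m phi k v) = ucoef m phi' k (L v).
Proof.
move=> Lphi; rewrite linear_sum; apply: eq_bigr => j _.
by rewrite linearZ /= (iter_dev_morph _ _ Lphi).
Qed.

(** The logarithm series starts with N, and its term in N^j raises degrees by j k >= k. *)
Lemma log_raises (M : topologicalType) (G : vsheaf K M)
    (pr : nat -> forall V, {linear G V -> G V}) (V : set M) (phi : G V -> G V)
    (k r : nat) v : (0 < k)%N ->
  (forall r v, gfilt pr r v -> gfilt pr (r + k) (phi v - v)) ->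
  gfilt pr r v -> gfilt pr (r + k) (ucoef m phi 1 v).
Proof.
move=> k0 phik Fv.
have Fiter j : gfilt pr (r + j * k) (iter j (dev phi) v).
  elim: j => [|j IH]; first by rewrite addn0.
  by rewrite mulSn addnCA addnC; apply: phik.
rewrite /ucoef big_ord_recl bin_poly0_coef1 scale0r add0r.
apply: gfilt_sum => j _; apply: gfiltZ; apply: gfilt_mono (Fiter _).
by rewrite leq_add2l mulSn leq_addr.
Qed.

Lemma iter_dev_raises (M : topologicalType) (G : vsheaf K M)
    (pr : nat -> forall V, {linear G V -> G V}) (V : set M) (phi : G V -> G V)
    (k j : nat) v : (0 < k)%N ->
  (forall r v, gfilt pr r v -> gfilt pr (r + k) (phi v - v)) ->
  gfilt pr j (iter j (dev phi) v).
Proof.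
move=> k0 phik; elim: j => [//|j IH].
by apply: (@gfilt_mono _ _ _ _ _ (j + k)); [rewrite -addn1 leq_add2l|apply: phik].
Qed.

End Logarithm.

(** * Logarithms of quasi-automorphisms and their leading terms *)

Section QuasiAutomorphisms.
Variables (K : numFieldType) (M : topologicalType) (m : nat).
Variables (O : sasheaf K M) (GO : gralg O).
Variables (E : msheaf O) (GE : grmod GO E).
Hypothesis nilO : forall V (f : O V), open V -> filt (E := reg O) m.+1 f -> f = 0.
Hypothesis nilE : forall V (e : E V), open V -> filt m.+1 e -> e = 0.
Implicit Types U V W : set M.

Local Notation prO := (ga_pr GO).
Local Notation prE := (gm_pr GE).
Local Notation grE := (gm_gr GE).

Lemma is_hom_log U (F : vsheaf K M) (Phi : fam F F) :
  is_hom U Phi -> is_hom U (fun V => ucoef m (@Phi V) 1).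
Proof.
move=> hom V oV VU; have [lin Ppar Pres] := hom V oV VU; split.
- pose L := HB.pack_for {linear F V -> F V} (@Phi V)
    (GRing.isLinear.Build K (F V) (F V) *:%R _ lin).
  by move=> a s t; apply: (ucoef_linear m L 1).
- by move=> b s; symmetry; apply: ucoef_morph => v; rewrite Ppar.
by move=> W s oW WV; symmetry; apply: ucoef_morph => v; rewrite Pres.
Qed.

(** Unipotency of Phi and Psi comes from the filtrations: each application of Phi - 1 or Psi - 1
    gains at least one degree, and degrees above m vanish. *)
Lemma QDer12_log k U (Phi : fam GE GE) : (0 < k)%N -> QAut k 2 U Phi ->
  exists A : fam GE GE, QDer12 U A /\ fam_eq U (qexp m A) Phi.
Proof.
move=> k0 [Psi [isoPsi [homPhi _] sl PhiE Psi2]].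
have PsiE V f r : open V -> V `<=` U -> gfilt prO r f ->
    gfilt prO (r + 2) (Psi V f - f).
  by move=> oV VU Ff; rewrite addn2; apply: (gfilt_alg_iso nilO isoPsi).
have homPsi : is_hom U Psi := isoPsi.1.1.
have PsiU V : open V -> V `<=` U -> unipotent m (Psi V).
  move=> oV VU f; apply: (gfilt_nil (ga_gr GO) nilO) => //.
  by apply: (iter_dev_raises (k := 2)) => // r g; apply: PsiE.
have PhiU V : open V -> V `<=` U -> unipotent m (Phi V).
  move=> oV VU f; apply: (gfilt_nil grE nilE) => //.
  by apply: (iter_dev_raises (k := k)) => // r g; apply: PhiE.
have Psi_lin V : open V -> V `<=` U -> linear (Psi V).
  by move=> oV VU a f g; have [+ _ _] := homPsi V oV VU; apply.
have Phi_lin V : open V -> V `<=` U -> linear (Phi V).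
  by move=> oV VU a f g; have [+ _ _] := homPhi V oV VU; apply.
exists (fun V => ucoef m (Phi V) 1); split; last first.
  move=> V v oV VU.
  by rewrite [RHS](exp_log_unipotent v (Phi_lin V oV VU) (PhiU V oV VU)).
exists (fun V => ucoef m (Psi V) 1); split.
- exact: is_hom_log.
- exact: is_hom_log.
- move=> V f g oV VU; apply: (log_derivation (b := @mul K M GO V)) => //.
  + exact: mul_linear.
  + exact: mul_linearl.
  + exact: Psi_lin.
  + exact: Psi_lin.
  + exact: PsiU.
  + exact: PsiU.
  + by move=> f' g'; have [+ _] := isoPsi.2 V oV VU; apply.
- move=> V f v oV VU; apply: (log_derivation (b := @act K M GO GE V)) => //.
  + exact: act_linear.
  + exact: act_linearl.
  + exact: Psi_lin.
  + exact: Phi_lin.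
  + exact: PsiU.
  + exact: PhiU.
  + by move=> f' v'; apply: sl.
move=> V r oV VU; split=> [v Fv|f Ff].
  apply: (@gfilt_mono _ _ _ _ _ (r + k)); first by rewrite -addn1 leq_add2l.
  by apply: log_raises => // r' v'; apply: PhiE.
by rewrite -addn2; apply: log_raises => // r' f'; apply: PsiE.
Qed.

(** [qlog] is a choice among the logarithms in [QDer12]; this specification is all that is used of
    it. *)
Lemma qlogP U (Phi : fam GE GE) :
  (exists A : fam GE GE, QDer12 U A /\ fam_eq U (qexp m A) Phi) ->
  QDer12 U (qlog m U Phi) /\ fam_eq U (qexp m (qlog m U Phi)) Phi.
Proof.
by rewrite /qlog => ex; case: pselect => // h; apply: (projT2 (cid h)).
Qed.

(** Write Phi - 1 = A + [rest]. If A raises degrees by j, then [rest] raises them by 2j, so A = (Phi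
    - 1) - [rest] raises them by j + 1 as long as j < k. Once j = k is reached, [rest] does not
    contribute to degree p + k. *)
Lemma mu_principal k U (Phi : fam GE GE) p V (v : GE V) : (0 < k)%N ->
  QAut k 2 U Phi -> open V -> V `<=` U -> prE p V v = v ->
  mu m k U Phi v = prE (p + k) V (Phi V v - v).
Proof.
move=> k0 PhiQ oV VU prv; have [_ [_ _ _ PhiE _]] := PhiQ.
have := qlogP (QDer12_log k0 PhiQ); rewrite /mu; set A := qlog _ _ _.
move=> [[Gam [_ homA _ _ raiseA]] expA].
have A_lin : linear (A V) by move=> a s t; have [+ _ _] := homA V oV VU; apply.
have raise_iter j l r (w : GE V) :
    (forall r (w : GE V), gfilt prE r w -> gfilt prE (r + j) (A V w)) ->
    gfilt prE r w -> gfilt prE (r + l * j) (iter l (A V) w).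
  move=> raise Fw; elim: l => [|l IH]; first by rewrite addn0.
  by rewrite mulSn addnCA addnC; apply: raise.
have raise1 r (w : GE V) : gfilt prE r w -> gfilt prE (r + 1) (A V w).
  by move=> Fw; rewrite addn1; have [+ _] := raiseA V r oV VU; apply.
pose rest w := \sum_(l < m) (l.+2`!%:R : K)^-1 *: iter l.+2 (A V) w.
have restE w : Phi V w - w = A V w + rest w.
  rewrite -expA // /qexp.
  (* The vanishing term l = m + 1 is added so that the terms 0 and 1 can be split off even when m =
     0. *)
  have -> : \sum_(l < m.+1) (l`!%:R : K)^-1 *: iter l (A V) w =
            \sum_(l < m.+2) (l`!%:R : K)^-1 *: iter l (A V) w.
    rewrite [RHS]big_ord_recr /= -[A V (iter m _ _)]/(iter m.+1 (A V) w).
    rewrite (gfilt_nil grE nilE oV (v := iter m.+1 (A V) w)) ?scaler0 ?addr0 //.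
    by have := @raise_iter 1 m.+1 0 w raise1; rewrite muln1; apply.
  rewrite 2!big_ord_recl /= invr1 !scale1r addrC addrA [- w + w]addrC subrr.
  by rewrite add0r.
have rest_raises j r w :
    (forall r (w : GE V), gfilt prE r w -> gfilt prE (r + j) (A V w)) ->
    gfilt prE r w -> gfilt prE (r + (j + j)) (rest w).
  move=> raise Fw; apply: gfilt_sum => l _; apply: gfiltZ.
  apply: gfilt_mono (raise_iter j l.+2 r w raise Fw).
  by rewrite leq_add2l !mulSn addnA leq_addr.
have raise j : (0 < j <= k)%N ->
    forall r (w : GE V), gfilt prE r w -> gfilt prE (r + j) (A V w).
  elim: j => // -[|j] IH; first by move=> _; apply: raise1.
  move=> /andP[_ jk] r w Fw.
  have -> : A V w = (Phi V w - w) - rest w by rewrite restE addrK.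
  have {}IH := IH (ltnW jk).
  apply: gfiltB.
    by apply: gfilt_mono (PhiE V r w oV VU Fw); rewrite leq_add2l.
  apply: gfilt_mono (rest_raises j.+1 r w IH Fw).
  by rewrite leq_add2l addSn addnS !ltnS leq_addr.
have Fv : gfilt prE p v by rewrite -prv; apply: (gfilt_pr grE).
have -> : prE (p + k) V (Phi V v - v) = prE (p + k) V (A V v).
  have raisek := raise k; rewrite k0 leqnn in raisek.
  rewrite restE linearD /= (rest_raises k p v (raisek isT) Fv) ?addr0 //.
  by rewrite ltn_add2l -[X in (X < _)%N]addn0 ltn_add2l.
have pr0 q : q != p -> prE q V v = 0.
  by move=> qp; rewrite -prv (gr_pr_proj grE) (negPf qp).
(* The sum in [mu] stops at degree m; a homogeneous v of higher degree is 0. *)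
have [pm|mp] := ltnP p m.+1.
  rewrite (bigD1 (Ordinal pm)) //= prv big1 ?addr0 // => q.
  by rewrite -val_eqE /= => /pr0 ->; rewrite (linear_fun0 A_lin) linear0.
have v0 : v = 0 by rewrite -prv (pr_out grE nilE).
rewrite v0 (linear_fun0 A_lin) linear0 big1 // => q _.
by rewrite linear0 (linear_fun0 A_lin) linear0.
Qed.

End QuasiAutomorphisms.

(** * The Cech complex *)

Section Cochains.
Variables (K : numFieldType) (M : topologicalType) (I : Type) (U : I -> set M).
Hypothesis oU : forall i, open (U i).

Lemma open_inter n (s : 'I_n.+1 -> I) : open (inter U s).
Proof.
elim: n s => [|n IH] s.
  suff -> : inter U s = U (s ord0) by [].
  by apply/seteqP; split=> [x|x Ux j]; [apply|rewrite (ord1 j)].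
suff -> : inter U s = U (s ord0) `&` inter U (s \o lift ord0).
  by apply: openI.
apply/seteqP; split=> [x Ux|x [U0 Ux] j]; first by split=> // j; apply: Ux.
by case: (unliftP ord0 j) => [j'|] ->; [apply: Ux|].
Qed.

Lemma inter_lift n (s : 'I_n.+2 -> I) j : inter U s `<=` inter U (s \o lift j).
Proof. by move=> x Ux i; apply: Ux. Qed.

Lemma inter_head n (s : 'I_n.+1 -> I) j : inter U s `<=` U (s j).
Proof. by move=> x; apply. Qed.

Section Coboundary.
Variable F : vsheaf K M.

Lemma cechdD n (c c' : cochain U F n) :
  cechd (fun s => c s + c' s) = fun s => cechd c s + cechd c' s.
Proof.
apply: functional_extensionality_dep => s; rewrite -big_split.
by apply: eq_bigr => j _; rewrite /= linearD scalerDr.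
Qed.

Lemma cechdB n (c c' : cochain U F n) :
  cechd (fun s => c s - c' s) = fun s => cechd c s - cechd c' s.
Proof.
apply: functional_extensionality_dep => s; rewrite -sumrB.
by apply: eq_bigr => j _; rewrite /= linearB scalerBr.
Qed.

Lemma cechd0 n : cechd ((fun=> 0) : cochain U F n) = fun=> 0.
Proof.
apply: functional_extensionality_dep => s.
by rewrite /cechd big1 // => j _; rewrite linear0 scaler0.
Qed.

Lemma cechd_sum n N (c : 'I_N -> cochain U F n) :
  cechd (fun s => \sum_q c q s) = fun s => \sum_q cechd (c q) s.
Proof.
apply: functional_extensionality_dep => s; rewrite exchange_big.
by apply: eq_bigr => j _; rewrite linear_sum scaler_sumr.
Qed.

Let swap n (ji : 'I_n.+3 * 'I_n.+2) : 'I_n.+3 * 'I_n.+2 :=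
  (lift ji.1 ji.2, inord (unbump ji.2 ji.1)).

Let unbump_ltn n (j : 'I_n.+3) (i : 'I_n.+2) : (unbump i j < n.+2)%N.
Proof. by have := ltn_ord i; have := ltn_ord j; rewrite /unbump; lia. Qed.

Let swapK n : involutive (@swap n).
Proof.
move=> [j i]; congr (_, _); apply: val_inj => /=; rewrite !inordK ?unbump_ltn //.
  by rewrite /bump /unbump; lia.
  by rewrite /bump /unbump; lia.
by have := ltn_ord i; rewrite /bump /unbump; lia.
Qed.

(* The terms of d (d c) cancel in pairs under the involution
   (j, i) |-> (bump j i, unbump i j) of the pairs of omitted indices. *)
Lemma cechdd n (c : cochain U F n) : cechd (cechd c) = fun=> 0.
Proof.
apply: functional_extensionality_dep => s.
pose T (t : 'I_n.+1 -> I) := res (inter U t) (inter U s) (c t).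
pose A (ji : 'I_n.+3 * 'I_n.+2) :=
  ((-1) ^+ (ji.1 + ji.2) : K) *: T (s \o (lift ji.1 \o lift ji.2)).
have -> : cechd (cechd c) s = \sum_ji A ji.
  rewrite -(pair_bigA _ (fun j i => A (j, i))) /=; apply: eq_bigr => j _.
  rewrite linear_sum scaler_sumr; apply: eq_bigr => i _.
  rewrite linearZ /= scalerA -exprD res_comp //; try exact: open_inter.
    exact: inter_lift.
  exact: inter_lift.
have AswapN ji : A (swap ji) = - A ji.
  case: ji => j i; rewrite /A /swap /=.
  have -> : lift (lift j i) \o lift (inord (unbump i j) : 'I_n.+2) =
      lift j \o lift i.
    apply/funext => x; apply: val_inj => /=.
    by rewrite inordK ?unbump_ltn // -bumpC.
  rewrite -scaleNr inordK ?unbump_ltn //; congr (_ *: _).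
  rewrite -signr_odd -[in RHS]signr_odd.
  have -> : odd (bump j i + unbump i j) = ~~ odd (j + i).
    by rewrite /bump /unbump; lia.
  by case: odd; rewrite ?opprK.
have sumN : \sum_ji A ji = - \sum_ji A ji.
  rewrite {1}(reindex_inj (inv_inj (@swapK n))) -sumrN.
  by apply: eq_bigr => ji _; apply: AswapN.
have : (2%:R : K) *: (\sum_ji A ji) = 0 by rewrite scaler_nat mulr2n {1}sumN addNr.
by move/eqP; rewrite scaler_eq0 pnatr_eq0 => /eqP.
Qed.

End Coboundary.
End Cochains.

(** * The spectral sequence, transported to cochains of gr E *)

Section SpectralSequence.
Variables (K : numFieldType) (M : topologicalType) (m : nat).
Variables (O : sasheaf K M) (GO : gralg O) (E : msheaf O) (GE : grmod GO E).
Hypothesis nilO : forall V (f : O V), open V -> filt (E := reg O) m.+1 f -> f = 0.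
Hypothesis nilE : forall V (e : E V), open V -> filt m.+1 e -> e = 0.
Variables (I : Type) (U : I -> set M) (oU : forall i, open (U i)).
Variables (sigma : I -> fam O GO) (delta : I -> fam E GE).
Hypothesis split_delta : is_splitting U sigma delta.
Variable k : nat.
Hypothesis k_gt0 : (0 < k)%N.
Hypothesis delta_k : qcocycle k 2 U (agamma delta).

Local Notation prE := (gm_pr GE).
Local Notation grE := (gm_gr GE).

Let oI n (s : 'I_n.+1 -> I) : open (inter U s) := open_inter oU s.
Let UI n (s : 'I_n.+1 -> I) j : inter U s `<=` U (s j) := @inter_head M I U n s j.

Lemma delta_linear i V : open V -> V `<=` U i -> linear (@delta i V).
Proof.
have [_ _ [hom _] _ _] := split_delta i.
by move=> oV VU; have [+ _ _] := hom V oV VU.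
Qed.

Lemma delta_res i V W e : open V -> V `<=` U i -> open W -> W `<=` V ->
  delta i (res V W e) = res V W (delta i e).
Proof.
have [_ _ [hom _] _ _] := split_delta i.
by move=> oV VU oW WV; have [_ _ ->] := hom V oV VU.
Qed.

Lemma delta_bij i V : open V -> V `<=` U i -> bijective (@delta i V).
Proof. by have [_ _ [_ bij] _ _] := split_delta i; apply: bij. Qed.

Lemma agamma_delta i j V (e : E V) : open V -> V `<=` U j ->
  agamma delta i j (delta j e) = delta i e.
Proof.
move=> oV VU; rewrite /agamma /fam_inv; congr (delta i _).
apply: xget_unique => //= e'; exact: (bij_inj (delta_bij oV VU)).
Qed.

(* tr identifies the cochains of E with those of gr E; it turns the coboundary
   d into d + twist, where twist raises the filtration by k. *)
Definition tr n (x : cochain U E n) : cochain U GE n :=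
  fun s => delta (s ord0) (x s).

Definition twist n (y : cochain U GE n) : cochain U GE n.+1 := fun s =>
  let z := res _ (inter U s) (y (s \o lift ord0)) in
  agamma delta (s ord0) (s (lift ord0 ord0)) z - z.

Definition prc p n (y : cochain U GE n) : cochain U GE n :=
  fun s => prE p _ (y s).

Definition gf p n (y : cochain U GE n) := forall s, gfilt prE p (y s).

Lemma trD n (x x' : cochain U E n) :
  tr (fun s => x s + x' s) = fun s => tr x s + tr x' s.
Proof.
apply: functional_extensionality_dep => s.
exact/linear_funD/delta_linear.
Qed.

Lemma trB n (x x' : cochain U E n) :
  tr (fun s => x s - x' s) = fun s => tr x s - tr x' s.
Proof.
apply: functional_extensionality_dep => s.
exact/linear_funB/delta_linear.
Qed.

Lemma tr0 n : tr ((fun=> 0) : cochain U E n) = fun=> 0.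
Proof.
apply: functional_extensionality_dep => s.
exact/linear_fun0/delta_linear.
Qed.

Lemma tr_surj n (y : cochain U GE n) : exists x, tr x = y.
Proof.
have inv s : {e | delta (s ord0) e = y s}.
  apply: cid; have [t _ tK] := delta_bij (oI s) (@UI _ s ord0).
  by exists (t (y s)).
exists (fun s => projT1 (inv s)).
apply: functional_extensionality_dep => s; exact: (projT2 (inv s)).
Qed.

Lemma tr_filt p n (x : cochain U E n) :
  (forall s, filt p (x s)) <-> gf p (tr x).
Proof.
have F s : filt p (x s) <-> gfilt prE p (tr x s).
  have [_ _ _ _ ind] := split_delta (s ord0).
  exact: (filt_induces_id grE p (x s) ind (oI s) (@UI _ s ord0)).
by split=> Fx s; apply/F.
Qed.

Lemma pi_tr p n (x : cochain U E n) : (forall s, filt p (x s)) ->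
  (fun s => gm_pi GE p (x s)) = prc p (tr x).
Proof.
move=> Fx; apply: functional_extensionality_dep => s.
have [_ _ _ _ ind] := split_delta (s ord0).
by have [_ prE_delta] := ind p _ (x s) (oI s) (@UI _ s ord0) (Fx s).
Qed.

(** A face omitting a later index still starts at i0 and is transported by the same delta; the face
    omitting i0 starts at i1, and the change of delta produces the twist. *)
Lemma tr_cechd n (x : cochain U E n) :
  tr (cechd x) = fun s => cechd (tr x) s + twist (tr x) s.
Proof.
apply: functional_extensionality_dep => s.
have lin := delta_linear (oI s) (@UI _ s ord0).
rewrite /tr /cechd (linear_fun_sum lin) /twist.
rewrite [LHS]big_ord_recl [in RHS]big_ord_recl /= !expr0 !scale1r.
have hd : lift (lift ord0 _) ord0 = ord0 :> 'I_n.+2 by move=> i; apply: val_inj.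
rewrite -[X in agamma _ _ _ X]delta_res //; last 2 first.
- exact: (@UI _ (s \o lift ord0) ord0).
- exact: inter_lift.
rewrite agamma_delta //.
rewrite [RHS]addrC addrA subrK; congr (_ + _); apply: eq_bigr => i _.
rewrite (linear_funZ lin) hd delta_res //; last exact: inter_lift.
by rewrite -[X in _ `<=` U (s X)](hd i);
  apply: (@UI _ (s \o lift (lift ord0 i)) ord0).
Qed.

Let agamma_QAut i j : QAut k 2 (U i `&` U j) (agamma delta i j).
Proof. exact: delta_k.1. Qed.

Let sub2 n (s : 'I_n.+2 -> I) :
  inter U s `<=` U (s ord0) `&` U (s (lift ord0 ord0)).
Proof. by move=> x Ux; split; apply: Ux. Qed.

Let agamma_linear n (s : 'I_n.+2 -> I) :
  linear (agamma delta (s ord0) (s (lift ord0 ord0)) (V := inter U s)).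
Proof.
have [Psi [_ [hom _] _ _ _]] := agamma_QAut (s ord0) (s (lift ord0 ord0)).
by have [lin _ _] := hom _ (oI s) (@sub2 _ s).
Qed.

Lemma twistD n (y y' : cochain U GE n) :
  twist (fun s => y s + y' s) = fun s => twist y s + twist y' s.
Proof.
apply: functional_extensionality_dep => s.
by rewrite /twist linearD /= (linear_funD (@agamma_linear _ s)) opprD addrACA.
Qed.

Lemma gf_twist p n (y : cochain U GE n) : gf p y -> gf (p + k) (twist y).
Proof.
move=> Fy s.
have [Psi [_ _ _ raise _]] := agamma_QAut (s ord0) (s (lift ord0 ord0)).
apply: raise => //; apply: (gfilt_res grE) => //; exact: inter_lift.
Qed.

Lemma twist_principal p n (y : cochain U GE n) : Cgr p y ->
  prc (p + k) (twist y) = mu_cochain m k (agamma delta) y.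
Proof.
move=> Cy; apply: functional_extensionality_dep => s.
rewrite /mu_cochain (mu_principal nilO nilE (p := p) k_gt0 (agamma_QAut _ _)) //.
by rewrite (gr_pr_res grE) ?Cy //; apply: inter_lift.
Qed.

Lemma prcD p n (y y' : cochain U GE n) :
  prc p (fun s => y s + y' s) = fun s => prc p y s + prc p y' s.
Proof. by apply: functional_extensionality_dep => s; rewrite /prc linearD. Qed.

Lemma prcB p n (y y' : cochain U GE n) :
  prc p (fun s => y s - y' s) = fun s => prc p y s - prc p y' s.
Proof. by apply: functional_extensionality_dep => s; rewrite /prc linearB. Qed.

Lemma prc_gf p q n (y : cochain U GE n) : gf q y -> (p < q)%N ->
  prc p y = fun=> 0.
Proof. by move=> Fy pq; apply: functional_extensionality_dep => s; apply: Fy. Qed.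

Lemma prc_cechd p n (y : cochain U GE n) : prc p (cechd y) = cechd (prc p y).
Proof.
apply: functional_extensionality_dep => s.
rewrite /prc /cechd linear_sum; apply: eq_bigr => j _.
rewrite linearZ /= (gr_pr_res grE) //; exact: inter_lift.
Qed.

Lemma Cgr_prc p n (y : cochain U GE n) : Cgr p (prc p y).
Proof. by move=> s; rewrite /prc (gr_pr_proj grE) eqxx. Qed.

Lemma prc_Cgr p n (y : cochain U GE n) : Cgr p y -> prc p y = y.
Proof. by move=> Cy; apply: functional_extensionality_dep => s; apply: Cy. Qed.

Lemma Cgr_gf p n (y : cochain U GE n) : Cgr p y -> gf p y.
Proof. by move=> Cy s; rewrite -Cy; apply: (gfilt_pr grE). Qed.

Lemma gf_mono p q n (y : cochain U GE n) : (p <= q)%N -> gf q y -> gf p y.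
Proof. by move=> pq Fy s; apply: gfilt_mono (Fy s). Qed.

Lemma gfD p n (y y' : cochain U GE n) : gf p y -> gf p y' ->
  gf p (fun s => y s + y' s).
Proof. by move=> Fy Fy' s; apply: gfiltD. Qed.

Lemma gfB p n (y y' : cochain U GE n) : gf p y -> gf p y' ->
  gf p (fun s => y s - y' s).
Proof. by move=> Fy Fy' s; apply: gfiltB. Qed.

Lemma gf0 p n : gf p ((fun=> 0) : cochain U GE n).
Proof. by move=> s; apply: gfilt0. Qed.

Lemma prc_tr_cechd p q n (x : cochain U E n) : gf p (tr x) -> (q < p + k)%N ->
  prc q (tr (cechd x)) = cechd (prc q (tr x)).
Proof.
move=> Fx qpk; rewrite tr_cechd prcD (prc_gf (gf_twist Fx) qpk) prc_cechd.
by apply: functional_extensionality_dep => s; rewrite addr0.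
Qed.

Lemma filt_cechd p n (x : cochain U E n) :
  (forall s, filt p (x s)) -> forall s, filt p (cechd x s).
Proof.
move=> Fx s; apply: filt_sum => // j.
rewrite -[_ *: _]addr0; apply: filt_linear => //; last exact: filt0.
by apply: filt_res => //; apply: inter_lift.
Qed.

Definition cut (p : int) : nat := if p is Posz p' then p' else 0.

Lemma cut_le p q : p <= q -> (cut p <= cut q)%N.
Proof. by case: p q => [p|p] [q|q]. Qed.

Lemma le_cut p : p <= (cut p)%:Z.
Proof. by case: p. Qed.

Lemma CspecP r p n (x : cochain U E n) :
  Cspec r p x <-> gf (cut p) (tr x) /\ gf (cut (p + r)) (tr (cechd x)).
Proof.
split=> [[/tr_filt Fx /tr_filt Fdx]|[/tr_filt Fx /tr_filt Fdx]]; split=> //.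
Qed.

Definition subgroup (F : vsheaf K M) n (B : set (cochain U F n)) :=
  B (fun=> 0) /\ forall x y, B x -> B y -> B (fun s => x s - y s).

Lemma subgroupN (F : vsheaf K M) n (B : set (cochain U F n)) x :
  subgroup B -> B x -> B (fun s => - x s).
Proof.
move=> [B0 BB] Bx; have := BB _ _ B0 Bx.
by congr (B _); apply: functional_extensionality_dep => s; rewrite sub0r.
Qed.

Lemma subgroupD (F : vsheaf K M) n (B : set (cochain U F n)) x y :
  subgroup B -> B x -> B y -> B (fun s => x s + y s).
Proof.
move=> gB Bx /(subgroupN gB) By; have := gB.2 _ _ Bx By.
by congr (B _); apply: functional_extensionality_dep => s; rewrite opprK.
Qed.

Lemma coset_self (F : vsheaf K M) n (B : set (cochain U F n)) x :
  subgroup B -> coset B x x.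
Proof.
move=> [B0 _]; rewrite /coset /=.
have -> // : (fun s => x s - x s) = fun=> 0.
by apply: functional_extensionality_dep => s; rewrite subrr.
Qed.

Lemma coset_eqP (F : vsheaf K M) n (B : set (cochain U F n)) x y :
  subgroup B -> coset B x = coset B y <-> B (fun s => x s - y s).
Proof.
move=> gB; split=> [xy|Bxy]; first by have := coset_self x gB; rewrite xy.
apply/seteqP; split=> z /= Bz.
  have := subgroupD gB Bz Bxy; rewrite /coset /=.
  by congr (B _); apply: functional_extensionality_dep => s; rewrite addrA subrK.
have := gB.2 _ _ Bz Bxy; rewrite /coset /=.
congr (B _); apply: functional_extensionality_dep => s.
by rewrite opprB addrA subrK.
Qed.

Lemma subgroup_Cspec r p n : subgroup (@Cspec _ _ _ U _ E r p n).
Proof.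
split.
  by apply/CspecP; rewrite cechd0 !tr0; split; apply: gf0.
move=> x y /CspecP[Fx Fdx] /CspecP[Fy Fdy]; apply/CspecP.
by rewrite cechdB !trB; split; apply: gfB.
Qed.

Lemma subgroup_cech_im (F : vsheaf K M) (A : forall n, set (cochain U F n)) n :
  (forall n, subgroup (A n)) -> subgroup (cech_im A (n := n)).
Proof.
case: n => [|n] gA.
  split=> // x y -> ->; apply: functional_extensionality_dep => s.
  by rewrite subr0.
split; first by exists (fun=> 0); [apply: (gA n).1|rewrite cechd0].
move=> _ _ [x Ax <-] [y Ay <-]; exists (fun s => x s - y s).
  exact: (gA n).2.
by rewrite cechdB.
Qed.

Lemma subgroup_Bspec r p n : subgroup (@Bspec _ _ _ U _ E r p n).
Proof.
have gC := subgroup_Cspec.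
have gI := subgroup_cech_im n (gC (r - 1) (p - r + 1)).
split.
  exists (fun=> 0), (fun=> 0); split; [exact: (gC _ _ _).1|exact: gI.1|].
  by apply: functional_extensionality_dep => s; rewrite addr0.
move=> _ _ [x [y [Cx Iy ->]]] [x' [y' [Cx' Iy' ->]]].
exists (fun s => x s - x' s), (fun s => y s - y' s); split.
- exact: (gC _ _ _).2.
- exact: gI.2.
by apply: functional_extensionality_dep => s; rewrite opprD addrACA.
Qed.

Lemma subgroup_Cgr p n : subgroup (@Cgr _ _ _ U _ _ _ GE p n).
Proof.
split=> [s|x y Cx Cy s]; first by rewrite linear0.
by rewrite linearB /= Cx Cy.
Qed.

Lemma Bspec_l r p n (x : cochain U E n) :
  Cspec (r - 1) (p + 1) x -> Bspec r p x.
Proof.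
move=> Cx; exists x, (fun=> 0); split => //.
  exact: (subgroup_cech_im _ (subgroup_Cspec _ _)).1.
by apply: functional_extensionality_dep => s; rewrite addr0.
Qed.

Lemma Bspec_r r p n (x : cochain U E n) :
  Cspec (r - 1) (p - r + 1) x -> Bspec r p (cechd x).
Proof.
move=> Cx; exists (fun=> 0), (cechd x); split.
- exact: (subgroup_Cspec _ _ _).1.
- by exists x.
by apply: functional_extensionality_dep => s; rewrite add0r.
Qed.

(** This is why d_r is well defined: d kills the exact summand, and it sends C^(p+1)_(r-1) to
    boundaries for the index p + r, because (p + r) - r + 1 = p + 1. *)
Lemma Bspec_cechd r p n (x : cochain U E n) :
  Bspec r p x -> Bspec r (p + r) (cechd x).
Proof.
move=> [u [v [Cu Iv ->]]] {x}.
have -> : cechd (fun s => u s + v s) = cechd u.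
  rewrite cechdD; have -> : cechd v = fun=> 0.
    by case: n u v Cu Iv => [|n] u v _ => [->|[w _ <-]]; rewrite ?cechd0 ?(cechdd oU).
  by apply: functional_extensionality_dep => s; rewrite addr0.
by apply: Bspec_r; have -> : p + r - r + 1 = p + 1 by lia.
Qed.

Lemma dspec_coset r p n (x : cochain U E n) :
  dspec r p (coset (@Bspec _ _ _ U _ E r p n) x) =
  coset (@Bspec _ _ _ U _ E r (p + r) n.+1) (cechd x).
Proof.
have gB := subgroup_Bspec r (p + r) n.+1.
apply/seteqP; split=> z.
  move=> [x' /Bspec_cechd Bx' zx'].
  have <- // : coset (@Bspec _ _ _ U _ E r (p + r) n.+1) (cechd x') =
               coset (@Bspec _ _ _ U _ E r (p + r) n.+1) (cechd x).
  by apply/coset_eqP => //; rewrite -cechdB.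
by move=> zx; exists x; first exact: (coset_self x (subgroup_Bspec r p n)).
Qed.

(* Split the cochain at degree p + r: the lower part is annihilated by d modulo
   degree p + k, the upper part lies in C^(p+1)_(r-1). *)
Lemma cechd_Bspec (r : nat) (p : int) n (x : cochain U E n) :
  (0 < r < k)%N -> Cspec r%:Z p x -> Bspec r%:Z (p + r%:Z) (cechd x).
Proof.
move=> /andP[r0 rk] /CspecP[Fx Fdx].
(* For p < 0 the filtration is the same at p and p + 1, so x itself lies in C^(p+1)_(r-1). *)
case: p Fx Fdx => p Fx Fdx; last first.
  apply: Bspec_r; apply/CspecP; split.
    by apply: gf_mono Fx; apply: (@cut_le _ 0); lia.
  by apply: gf_mono Fdx; apply: cut_le; lia.
rewrite -PoszD /= in Fx Fdx.
have [x' x'E] := tr_surj (fun s => \sum_(q < p + r) prc q (tr x) s).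
have Fx' : gf p (tr x').
  rewrite x'E => s; apply: gfilt_sum => q _.
  have [qp|pq] := ltnP q p; first by rewrite (prc_gf Fx qp); apply: gfilt0.
  exact: gfilt_mono pq (Cgr_gf (Cgr_prc _ _) s).
have dx' : gf (p + k) (tr (cechd x')).
  rewrite tr_cechd; apply: gfD; last exact: gf_twist.
  (* For q < p + r the coboundary of the component of degree q is the component of degree q of
     [tr (cechd x)], which vanishes. *)
  rewrite x'E cechd_sum => s; rewrite big1; first exact: gfilt0.
  move=> q _; rewrite -(prc_tr_cechd Fx) ?(prc_gf Fdx) //.
  by rewrite (leq_trans (ltn_ord q)) // leq_add2l ltnW.
have -> : cechd x = fun s => cechd x' s + cechd (fun s => x s - x' s) s.
  rewrite cechdB; apply: functional_extensionality_dep => s.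
  by rewrite addrC subrK.
have Fxx' : gf (p + r) (tr (fun s => x s - x' s)).
  by rewrite trB x'E => s; apply: (gfilt_trunc grE).
apply: (subgroupD (subgroup_Bspec _ _ _)).
  (* Here r < k enters: p + r + 1 <= p + k. *)
  apply: Bspec_l; apply/CspecP; rewrite (cechdd oU) tr0; split; last exact: gf0.
  by apply: gf_mono dx'; rewrite -!PoszD /=; lia.
apply: Bspec_r; apply/CspecP.
have -> : p%:Z + r%:Z - r%:Z + 1 = p.+1 by lia.
have -> : p.+1%:Z + (r%:Z - 1) = (p + r)%N by lia.
split; first by apply: gf_mono Fxx'; rewrite /= -addn1 leq_add2l.
by apply/tr_filt/filt_cechd/tr_filt.
Qed.

Lemma Bspec_filt p n (b : cochain U E n) : Bspec k p%:Z b -> gf p (tr b).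
Proof.
move=> [u [v [/CspecP[Fu _] Iv ->]]]; rewrite trD; apply: gfD.
  by apply: gf_mono Fu; rewrite -PoszD /= leq_addr.
case: n u v Fu Iv b => [|n] u v _; first by move=> ->; rewrite tr0 => _; apply: gf0.
move=> [w /CspecP[_ Fw] <-] _; apply: gf_mono Fw.
by apply: (@cut_le p); lia.
Qed.

(** A primitive w may start as low as degree p - k + 1, but its twist then starts above p, so in
    degree p the coboundary of w is that of its component. *)
Lemma Bspec_boundary p n (b : cochain U E n) :
  Bspec k p%:Z b -> cech_im (@Cgr _ _ _ U _ _ _ GE p) (prc p (tr b)).
Proof.
move=> [u [v [/CspecP[Fu _] Iv ->]]]; rewrite trD prcD.
have gI := subgroup_cech_im n (subgroup_Cgr p).
apply: (subgroupD gI).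
  rewrite (prc_gf Fu); first exact: gI.1.
  by rewrite -PoszD /= addn1.
case: n u v Fu Iv b gI => [|n] u v _.
  move=> -> _ gI; rewrite tr0 (prc_gf (@gf0 p.+1 0) (ltnSn p)); exact: gI.1.
move=> [w /CspecP[Fw _] <-] _ _.
exists (prc p (tr w)); first exact: Cgr_prc.
rewrite (prc_tr_cechd Fw) //.
by have := le_cut (p%:Z - k%:Z + 1); lia.
Qed.

(** A primitive in gr E lifts to a cochain v in C_(p). Subtracting d v from x removes the component
    of degree p, and the difference lies in C^(p+1)_(k-1). *)
Lemma boundary_Bspec p n (x : cochain U E n) : Cspec k p%:Z x ->
  cech_im (@Cgr _ _ _ U _ _ _ GE p) (prc p (tr x)) -> Bspec k p%:Z x.
Proof.
move=> /CspecP[Fx Fdx].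
have pE : p%:Z + 1 = p.+1 by lia.
have pkE : p.+1%:Z + (k%:Z - 1) = (p + k)%N by lia.
case: n x Fx Fdx => [|n] x Fx Fdx.
  move=> prx; apply: Bspec_l; rewrite pE; apply/CspecP; split; last by rewrite pkE.
  move=> s; apply: gfiltS; first exact: Fx.
  by have := congr1 (@^~ s) prx.
move=> [w Cw wE]; have [v vE] := tr_surj w.
have Fw : gf p (tr v) by rewrite vE; apply: Cgr_gf.
have dvE : prc p (tr (cechd v)) = prc p (tr x).
  by rewrite (prc_tr_cechd Fw) ?vE ?(prc_Cgr Cw) // -[X in (X < _)%N]addn0 ltn_add2l.
have Fdv : gf p (tr (cechd v)) by apply/tr_filt/filt_cechd/tr_filt.
have -> : x = fun s => (x s - cechd v s) + cechd v s.
  by apply: functional_extensionality_dep => s; rewrite subrK.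
apply: (subgroupD (subgroup_Bspec _ _ _)).
  apply: Bspec_l; rewrite pE; apply/CspecP; split.
    move=> s; apply: gfiltS; first by rewrite trB; apply: gfB.
    by have := congr1 (@^~ s) dvE; rewrite trB linearB /prc /= => ->; rewrite subrr.
  rewrite pkE cechdB (cechdd oU); have -> // : (fun s => cechd x s - 0) = cechd x.
  by apply: functional_extensionality_dep => s; rewrite subr0.
apply: Bspec_r; apply/CspecP; split.
  by apply: gf_mono Fw; apply: (@cut_le _ p); lia.
by apply: gf_mono Fdv; apply: (@cut_le _ p); lia.
Qed.

Lemma ident_coset p n (x : cochain U E n) : Cspec k p%:Z x ->
  ident GE p (coset (@Bspec _ _ _ U _ E k p%:Z n) x) = Hclass p (prc p (tr x)).
Proof.
move=> /CspecP[Fx _]; have gI := subgroup_cech_im n (subgroup_Cgr p).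
apply/seteqP; split=> c.
  move=> [x' Bxx' cx'].
  have Fx' : gf p (tr x').
    have := gfD (Bspec_filt Bxx') Fx; rewrite trB => F s.
    by have := F s; rewrite subrK.
  have {}cx' : Hclass p (prc p (tr x')) c.
    by move: cx'; rewrite (pi_tr (p := p) (x := x')) //; apply/tr_filt.
  have <- // : Hclass p (prc p (tr x')) = Hclass p (prc p (tr x)).
  by apply/(coset_eqP _ _ gI); rewrite -prcB -trB; apply: Bspec_boundary.
move=> cx; exists x; first exact: (coset_self x (subgroup_Bspec k p n)).
by rewrite (pi_tr (p := p) (x := x)) //; apply/tr_filt.
Qed.

Lemma Zgr_Cspec p n (x : cochain U E n) :
  Cspec k p%:Z x -> Zgr p (prc p (tr x)).
Proof.
move=> /CspecP[Fx Fdx]; have pk : (p < p + k)%N by lia.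
by split; [apply: Cgr_prc|rewrite -(prc_tr_cechd Fx) // (prc_gf Fdx)].
Qed.

Lemma ident_bij p n : set_bij (Espec U E k%:Z p%:Z n) (Hgr U GE p n) (ident GE p).
Proof.
have gI := subgroup_cech_im n (subgroup_Cgr p).
split.
- move=> _ [x Cx <-]; rewrite ident_coset //.
  by exists (prc p (tr x)) => //; apply: Zgr_Cspec.
- move=> _ _ /set_mem[x Cx <-] /set_mem[y Cy <-]; rewrite !ident_coset //.
  move/(coset_eqP _ _ gI); rewrite -prcB -trB => im.
  apply/(coset_eqP _ _ (subgroup_Bspec _ _ _)); apply: boundary_Bspec im.
  exact: (subgroup_Cspec _ _ _).2.
(* For a cocycle c, a lift x with [tr x = c] has [tr (cechd x)] equal to the twist of c, which
   starts at degree p + k. *)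
move=> _ [c [Cc dc] <-]; have [x xE] := tr_surj c.
have Cx : Cspec k p%:Z x.
  apply/CspecP; rewrite tr_cechd xE dc; split; first exact: Cgr_gf.
  by apply: gfD; [apply: gf0|apply/gf_twist/Cgr_gf].
exists (coset (@Bspec _ _ _ U _ E k p%:Z n) x); first by exists x.
by rewrite ident_coset // xE prc_Cgr.
Qed.

(* The component of degree p + k of d (d v) = 0, where tr v = w. *)
Lemma twist_boundary p n (h : cochain U GE n) :
  cech_im (@Cgr _ _ _ U _ _ _ GE p) h ->
  cech_im (@Cgr _ _ _ U _ _ _ GE (p + k)) (prc (p + k) (twist h)).
Proof.
have gI l := subgroup_cech_im l (subgroup_Cgr (p + k)).
case: n h => [|n] h.
  move=> ->; rewrite (prc_gf (gf_twist (@gf0 p.+1 0))) ?ltn_add2r //; exact: (gI _).1.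
move=> [w Cw <-]; have [v vE] := tr_surj w.
have dd0 : (fun s => cechd (tr (cechd v)) s + twist (tr (cechd v)) s) = fun=> 0.
  by rewrite -tr_cechd (cechdd oU) tr0.
(* [tr (cechd v)] is d w plus the twist of w, and the twist of the latter starts at degree p +
   2k. *)
have twistE : prc (p + k) (twist (tr (cechd v))) = prc (p + k) (twist (cechd w)).
  rewrite tr_cechd vE twistD prcD.
  have Ftw : gf (p + k + k) (twist (twist w)) by do 2!apply: gf_twist; apply: Cgr_gf.
  rewrite (prc_gf Ftw); last by rewrite -[X in (X < _)%N]addn0 ltn_add2l.
  by apply: functional_extensionality_dep => s; rewrite addr0.
have := congr1 (prc (p + k) (n := n.+2)) dd0.
rewrite prcD prc_cechd twistE => dd0'.
have -> : prc (p + k) (twist (cechd w)) =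
    fun s => - cechd (prc (p + k) (tr (cechd v))) s.
  apply: functional_extensionality_dep => s; apply/eqP; rewrite -addr_eq0 addrC.
  by have := congr1 (@^~ s) dd0'; rewrite {3}/prc linear0 => ->.
apply: (subgroupN (gI _)); exists (prc (p + k) (tr (cechd v))) => //.
exact: Cgr_prc.
Qed.

(** Decompose y = [tr x] as c + h + u, where h is the coboundary by which the component of degree p
    differs from c, and u has degree above p. In degree p + k the twist of c gives mu_k, that of h
    is a coboundary, that of u vanishes, and d y contributes another coboundary. *)
Lemma dspec_mu p n (c : cochain U GE n) (A : set (cochain U E n)) :
  Zgr p c -> Espec U E k%:Z p%:Z n A -> ident GE p A = Hclass p c ->
  ident GE (p + k)%N (dspec k%:Z p%:Z A) =
  Hclass (p + k)%N (mu_cochain m k (agamma delta) c).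
Proof.
move=> [Cc _] [x Cx <-]; rewrite ident_coset //.
have gI q l := subgroup_cech_im l (subgroup_Cgr q).
move=> /(coset_eqP _ _ (gI _ _)) /twist_boundary twist_im.
have [Fx Fdx] := (CspecP _ _ _).1 Cx.
rewrite dspec_coset -PoszD ident_coset; last first.
  apply/CspecP; split; first exact: Fdx.
  by rewrite (cechdd oU) tr0; apply: gf0.
apply/(coset_eqP _ _ (gI _ _)); rewrite -(twist_principal Cc) tr_cechd prcD prc_cechd.
set y := tr x in Fx twist_im *.
set h : cochain U GE n := fun s => prc p y s - c s in twist_im.
pose u : cochain U GE n := fun s => y s - prc p y s.
have Fu : gf p.+1 u.
  move=> s; apply: gfiltS.
    by apply: gfiltB; [apply: Fx|apply: (Cgr_gf (Cgr_prc p y))].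
  by rewrite linearB /prc (gr_pr_proj grE) eqxx subrr.
have yE : y = fun s => c s + (fun s => h s + u s) s.
  by apply: functional_extensionality_dep => s; rewrite addrA subrKC addrC subrK.
have twE : prc (p + k) (twist y) =
    fun s => prc (p + k) (twist c) s + prc (p + k) (twist h) s.
  rewrite yE (twistD c) (twistD h u) (prcD _ (twist c)) (prcD _ (twist h)).
  rewrite (prc_gf (gf_twist Fu)) ?ltn_add2r //.
  by apply: functional_extensionality_dep => s; rewrite addr0.
rewrite twE.
have -> : (fun s => cechd (prc (p + k) y) s + (prc (p + k) (twist c) s +
     prc (p + k) (twist h) s) - prc (p + k) (twist c) s) =
   fun s => cechd (prc (p + k) y) s + prc (p + k) (twist h) s.
  by apply: functional_extensionality_dep => s; rewrite -addrA [_ + _ - _]addrC addKr.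
apply: (subgroupD (gI _ _)) => //; exists (prc (p + k) y) => //; exact: Cgr_prc.
Qed.

Lemma dspec_zero (r : nat) (p : int) n (A : set (cochain U E n)) :
  (0 < r < k)%N -> Espec U E r%:Z p n A ->
  dspec r%:Z p A = zspec U E r%:Z (p + r%:Z) n.+1.
Proof.
move=> rk [x Cx <-]; rewrite dspec_coset.
apply/(coset_eqP _ _ (subgroup_Bspec _ _ _)).
have -> : (fun s => cechd x s - 0) = cechd x.
  by apply: functional_extensionality_dep => s; rewrite subr0.
exact: cechd_Bspec.
Qed.

End SpectralSequence.

Theorem theorem7 (R : realType) (M : topologicalType) (n m : nat)
    (O : sasheaf (cplx R) M) (hO : supermanifold n m O)
    (p0 q0 : nat) (E : msheaf O) (hE : locally_free p0 q0 E)
    (GO : gralg O) (GE : grmod GO E)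
    (I : Type) (U : I -> set M) (hU : open_cover U)
    (hstein : forall i, stein GO (U i))
    (sigma : I -> fam O GO) (delta : I -> fam E GE)
    (hsplit : is_splitting U sigma delta)
    (k : nat) (hk : has_order k U (agamma delta))
    (hdelta : qcocycle k 2 U (agamma delta)) :
  (forall r : nat, (1 <= r < k)%N ->
     forall (p : int) (d : nat) (A : set (cochain U E d)),
       Espec U E r%:Z p d A -> dspec r%:Z p A = zspec U E r%:Z (p + r%:Z) d.+1) /\
  (forall p d : nat,
     set_bij (Espec U E k%:Z p%:Z d) (Hgr U GE p d) (ident GE p)) /\
  (forall (p d : nat) (c : cochain U GE d) (A : set (cochain U E d)),
     Zgr p c -> Espec U E k%:Z p%:Z d A -> ident GE p A = Hclass p c ->
     ident GE (p + k)%N (dspec k%:Z p%:Z A) =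
     Hclass (p + k)%N (mu_cochain m k (agamma delta) c)).
Proof.
have nilE V (e : E V) : open V -> filt m.+1 e -> e = 0 := filt_nilpotent hO hE.
have nilO V (f : O V) : open V -> filt (E := reg O) m.+1 f -> f = 0 :=
  filt_nilpotent hO (@reg_locally_free _ _ _).
have [k_gt0 _ _] := hk.
have oU := hU.1.
split=> [r rk p d A EA|]; first exact: (dspec_zero oU hsplit k_gt0 hdelta rk EA).
split=> [p d|p d c A Zc EA].
  exact: (ident_bij oU hsplit k_gt0 hdelta).
exact: (dspec_mu nilO nilE oU hsplit k_gt0 hdelta Zc EA).
Qed.
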